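(* Let $V=\|U\|^2/(S+\|U\|^2)$ and $\hat\beta^{LS}=U^tZ/\|U\|^2$. Let $\psi,\bar\psi$ be real functions on $(0,1)$ and put $\hat\beta_\psi=\psi(V)\hat\beta^{LS}$, $\hat\beta_{\bar\psi}=\bar\psi(V)\hat\beta^{LS}$. Assume that the second moment of $\hat\beta_{\bar\psi}$ is finite. If $\psi^2(v)\le\bar\psi^2(v)$ and $$\Delta(v|\psi,\bar\psi)=\psi^2(v)-\bar\psi^2(v)-2(p+m-2)v\{\psi(v)-\bar\psi(v)\}\le 0$$ for any $v\in(0,1)$, then $\mathrm{MSE}(\hat\beta_\psi;\beta)\le\mathrm{MSE}(\hat\beta_{\bar\psi};\beta)$ (for all values of the parameters).
   Context: Model: $Z,U$ are $p$-dimensional random vectors and $S$ is a positive random variable, mutually independent, with $Z\sim N_p(\beta\xi,\tau^2I_p)$, $U\sim N_p(\xi,\sigma^2I_p)$, $S\sim\sigma^2\chi^2_m$. The parameters $\beta\in\mathbb{R}$, $\xi\in\mathbb{R}^p\setminus\{0\}$, $\sigma^2>0$, $\tau^2>0$ are unknown. Here $p=n-1$ and $m=n(r-1)$ for integers $n\ge2$, $r\ge2$. $\|\cdot\|$ is the Euclidean norm and $^t$ denotes transpose. For an estimator $\hat\beta$ of $\beta$, $\mathrm{MSE}(\hat\beta;\beta)=E[(\hat\beta-\beta)^2]$, with expectation under the model. Functions are understood to be Borel measurable. *)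

(* Defs.v *)
From HB Require Import structures.
From mathcomp Require Import all_boot all_order all_algebra.
From mathcomp Require Import all_classical all_reals all_analysis.

Set Implicit Arguments.
Unset Strict Implicit.
Unset Printing Implicit Defensive.

Import Order.TTheory GRing.Theory Num.Theory.
Import numFieldNormedType.Exports.

Local Open Scope classical_set_scope.
Local Open Scope ring_scope.

(* Vectors of R^p are p-tuples, which carry the product (= Borel) sigma-algebra;
   matrices carry no measurable structure, hence these two definitions. *)
Definition dot (R : realType) (p : nat) (u v : p.-tuple R) : R :=
  \sum_(i < p) tnth u i * tnth v i.

Definition enorm (R : realType) (p : nat) (u : p.-tuple R) : R :=
  Num.sqrt (dot u u).

Definition scale_tuple (R : realType) (p : nat) (a : R) (u : p.-tuple R) :
  p.-tuple R := [tuple a * tnth u i | i < p].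

(* Events may be taken to be the whole space, so this includes pairwise
   independence. *)
Definition independent3 (R : realType) (d d1 d2 d3 : measure_display)
    (T : measurableType d) (T1 : measurableType d1) (T2 : measurableType d2)
    (T3 : measurableType d3) (P : probability T R)
    (X : {RV P >-> T1}) (Y : {RV P >-> T2}) (W : {RV P >-> T3}) : Prop :=
  forall (A : set T1) (B : set T2) (C : set T3),
    measurable A -> measurable B -> measurable C ->
    P (X @^-1` A `&` Y @^-1` B `&` W @^-1` C) =
    (P (X @^-1` A) * P (Y @^-1` B) * P (W @^-1` C))%E.

Arguments independent3 {R d d1 d2 d3 T T1 T2 T3} P X Y W.

(* X ~ N_p(mu, v I_p): the law of X is the product of the N(mu_i, v), a product
   measure being determined by its values on measurable boxes. The argument v
   is the variance, whereas normal_prob expects the standard deviation. *)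
Definition spherical_normal (R : realType) (d : measure_display)
    (T : measurableType d) (P : probability T R) (p : nat)
    (X : {RV P >-> p.-tuple R}) (mu : p.-tuple R) (v : R) : Prop :=
  forall A : 'I_p -> set R, (forall i, measurable (A i)) ->
    distribution P X [set x | forall i, A i (tnth x i)] =
    (\prod_(i < p) normal_prob (tnth mu i) (Num.sqrt v) (A i))%E.

Arguments spherical_normal {R d T} P {p} X mu v.

Definition Gamma (R : realType) (a : R) : R :=
  Rintegral (@lebesgue_measure R) `]0, +oo[ (fun t => t `^ (a - 1) * expR (- t)).

Definition chi2_pdf (R : realType) (k : nat) (x : R) : R :=
  if 0 < x then
    x `^ (k%:R / 2 - 1) * expR (- (x / 2)) / (2 `^ (k%:R / 2) * Gamma (k%:R / 2))
  else 0.

Definition chi2_prob (R : realType) (k : nat) (A : set R) : \bar R :=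
  (\int[lebesgue_measure]_(x in A) (chi2_pdf k x)%:E)%E.

(* S ~ v chi^2_k, for v > 0: S / v has the chi-square law. *)
Definition scaled_chi2 (R : realType) (d : measure_display)
    (T : measurableType d) (P : probability T R)
    (S : {RV P >-> R}) (v : R) (k : nat) : Prop :=
  forall A : set R, measurable A ->
    P [set w | A (S w / v)] = chi2_prob k A.

Arguments scaled_chi2 {R d T} P S v k.

Definition betaLS (R : realType) (p : nat) (u z : p.-tuple R) : R :=
  dot u z / enorm u ^+ 2.

Definition Vstat (R : realType) (p : nat) (u : p.-tuple R) (s : R) : R :=
  enorm u ^+ 2 / (s + enorm u ^+ 2).

(* If s > 0 then Vstat u s lies in ]0, 1[ unless u = 0, and betaLS 0 z = 0 since
   x / 0 = 0; hence the values of psi outside ]0, 1[ never matter. *)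
Definition beta_hat (R : realType) (T : Type) (p : nat) (psi : R -> R)
    (Z U : T -> p.-tuple R) (S : T -> R) (w : T) : R :=
  psi (Vstat (U w) (S w)) * betaLS (U w) (Z w).

Definition MSE (R : realType) (d : measure_display) (T : measurableType d)
    (P : probability T R) (bhat : T -> R) (beta : R) : \bar R :=
  'E_P[fun w => (bhat w - beta) ^+ 2].

Definition Delta (R : realType) (p m : nat) (psi psibar : R -> R) (v : R) : R :=
  psi v ^+ 2 - psibar v ^+ 2 -
  2 * (p%:R + m%:R - 2) * v * (psi v - psibar v).

(* Main.v *)
Require Import Defs.
From HB Require Import structures.
From mathcomp Require Import all_boot all_order all_algebra.
From mathcomp Require Import all_classical all_reals all_analysis.
From mathcomp Require Import measurable_realfun ring lra.

Set Implicit Arguments.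
Unset Strict Implicit.
Unset Printing Implicit Defensive.

Import Order.TTheory GRing.Theory Num.Theory.
Import numFieldNormedType.Exports.

Local Open Scope classical_set_scope.
Local Open Scope ring_scope.

(** Write b = U.Z / |U|^2, w0 = U.xi / |U|^2 and V for the statistic of the
    theorem. The argument is arranged so that all expectations are of
    nonnegative functions; finiteness enters only in one final cancellation.

    Removing Z. The law of Z is invariant under z |-> 2 beta xi - z, which
    exchanges b and 2 beta w0 - b. Averaging the squared error over this
    reflection gives
      E (psi b - beta)^2
        = E psi^2 (b - beta w0)^2 + beta^2 E (psi w0 - 1)^2,
    with psi taken at V. The first term is monotone in psi^2, hence only the
    second one, which involves U and S alone, has to be compared
    ([integral_loss], [le_integral_loss]).

    Symmetrising U. Put v = sigma^2, X = S / v, T = X + |U|^2 / v and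
    w = U.xi / v. The law of (U, X) is c e^w M, where M is its version with
    xi = 0. As M is invariant under u |-> -u, up to the factor c the second term
    is the M-integral of
      (psi^2 w0^2 + 1) cosh w - 2 psi w0 sinh w        ([integral_sym_loss]).
    Let q = p + m - 2 and let K = (psibar^2 - psi^2) / V^2, which is nonnegative.
    Since w0 = w / (V T) and w sinh w is nonnegative, Delta <= 0 implies
    that replacing psibar by psi lowers this integrand by at least B - A, where
      A = K w sinh w / (q T)   and   B = K w^2 cosh w / T^2
    ([sym_loss_gap]). It remains to see that the integral of A is at most that of
    B ([le_integral_gap]); if the integral for psibar is infinite there is nothing
    to prove, and otherwise B is integrable ([square_gap_le]), so that its integral
    can be cancelled.

    Rays. The dilation (u, x) |-> (r u, r^2 x) multiplies w by r and T by r^2,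
    and fixes V, hence K. M is e^(-T/2) times a measure that is homogeneous of
    degree p + m under these dilations, so that polar coordinates along them
    reduce the claim to every single ray ([integral_polar],
    [le_integral_radial]), where it reads
      t int_0^oo r^q a sinh(a r) e^(-t r^2/2) dr
        <= q int_0^oo r^(q-1) a^2 cosh(a r) e^(-t r^2/2) dr.
    The derivative of r^(q-1) a sinh(a r) e^(-t r^2/2) is the second integrand
    minus the first, minus
      (q-1) r^(q-2) a (a r cosh(a r) - sinh(a r)) e^(-t r^2/2),
    which is nonnegative because sinh x <= x cosh x for x >= 0; and that function
    vanishes at 0 and is nonnegative ([radial_sinh_le_cosh]). *)

(** * Transport of measures along maps, with density *)

(** This single relation covers densities (phi = id), dilations and reflections,
    so that its stability under products is proved once for all of them. *)
Definition transports (R : realType) d1 d2 (T1 : measurableType d1)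
    (T2 : measurableType d2) (nu : set T1 -> \bar R) (mu : set T2 -> \bar R)
    (phi : T1 -> T2) (rho : T2 -> R) : Prop :=
  [/\ measurable_fun setT phi, measurable_fun setT rho,
      (forall y, 0 <= rho y) &
   forall g : T2 -> \bar R, measurable_fun setT g -> (forall y, (0 <= g y)%E) ->
    (\int[nu]_x g (phi x) = \int[mu]_y (g y * (rho y)%:E))%E].

(** Tonelli on both sides, with the two hypotheses applied one variable at a
    time. *)
Lemma transports_prod (R : realType) d1 d2 e1 e2
    (T1 : measurableType d1) (T2 : measurableType d2)
    (U1 : measurableType e1) (U2 : measurableType e2)
    (nu1 : {sigma_finite_measure set T1 -> \bar R})
    (mu1 : {sigma_finite_measure set T2 -> \bar R})
    (nu2 : {sigma_finite_measure set U1 -> \bar R})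
    (mu2 : {sigma_finite_measure set U2 -> \bar R})
    (phi1 : T1 -> T2) (rho1 : T2 -> R) (phi2 : U1 -> U2) (rho2 : U2 -> R) :
  transports nu1 mu1 phi1 rho1 -> transports nu2 mu2 phi2 rho2 ->
  transports (nu1 \x nu2)%E (mu1 \x mu2)%E
    (fun z => (phi1 z.1, phi2 z.2)) (fun y => rho1 y.1 * rho2 y.2).
Proof.
move=> [mphi1 mrho1 rho10 H1] [mphi2 mrho2 rho20 H2].
have mphi : measurable_fun setT (fun z : T1 * U1 => (phi1 z.1, phi2 z.2)).
  by apply: measurable_fun_pair => //=; apply: measurableT_comp.
have mrho : measurable_fun setT (fun y : T2 * U2 => rho1 y.1 * rho2 y.2).
  by apply: measurable_funM; apply: measurableT_comp.
split => //; first by move=> y; exact: mulr_ge0.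
move=> g mg g0.
rewrite (fubini_tonelli1 (fun z => g (phi1 z.1, phi2 z.2))) //; last first.
  exact: measurableT_comp.
rewrite (fubini_tonelli1 (fun y => g y * (rho1 y.1 * rho2 y.2)%:E)%E); last 2 first.
- by apply: emeasurable_funM => //; exact/measurable_EFinP.
- by move=> y; rewrite mule_ge0// lee_fin mulr_ge0.
have mF : measurable_fun setT (fun x : T2 => \int[mu2]_v (g (x, v) * (rho2 v)%:E))%E.
  apply: (measurable_fun_fubini_tonelli_F (fun z : T2 * U2 => g z * (rho2 z.2)%:E)%E).
    by apply: emeasurable_funM => //; apply/measurable_EFinP; exact: measurableT_comp.
  by move=> y; rewrite mule_ge0// lee_fin.
transitivity (\int[nu1]_x \int[mu2]_v (g (phi1 x, v) * (rho2 v)%:E))%E.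
  apply: eq_integral => x _; rewrite /fubini_F/=.
  rewrite (H2 (fun v => g (phi1 x, v)))//.
  exact: (measurableT_comp mg (pair1_measurable _)).
rewrite (H1 (fun x => \int[mu2]_v (g (x, v) * (rho2 v)%:E))%E)//; last first.
  by move=> y; apply: integral_ge0 => v _; rewrite mule_ge0// lee_fin.
apply: eq_integral => y _; rewrite /fubini_F/=.
rewrite -ge0_integralZr//=; last 3 first.
- apply: emeasurable_funM; first exact: (measurableT_comp mg (pair1_measurable _)).
  exact/measurable_EFinP.
- by move=> v _; rewrite mule_ge0// lee_fin.
- by rewrite lee_fin.
by apply: eq_integral => v _; rewrite EFinM [in RHS]muleCA muleC muleA.
Qed.

(** * Product laws on tuples *)

Definition tcons (R : realType) p (z : R * p.-tuple R) : p.+1.-tuple R :=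
  [tuple of z.1 :: z.2].

Lemma measurable_tcons (R : realType) p : measurable_fun setT (@tcons R p).
Proof. exact: measurable_cons. Qed.

HB.instance Definition _ (R : realType) p :=
  isMeasurableFun.Build _ _ _ _ (@tcons R p) (@measurable_tcons R p).

(** Defined by recursion on the length so that integrals against it can be
    computed one coordinate at a time by Tonelli. *)
Fixpoint prod_law (R : realType) (p : nat) :
    ('I_p -> probability R R) -> probability (p.-tuple R) R :=
  match p with
  | 0 => fun _ => \d_[tuple]
  | p'.+1 => fun Q =>
      distribution (Q ord0 \x prod_law (fun i => Q (lift ord0 i)))%E (@tcons R p')
  end.

Definition box (R : realType) p (A : 'I_p -> set R) : set (p.-tuple R) :=
  [set t | forall i, A i (tnth t i)].

Lemma measurable_box (R : realType) p (A : 'I_p -> set R) :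
  (forall i, measurable (A i)) -> measurable (box A).
Proof.
move=> mA; rewrite (_ : box A = \bigcap_(i in [set: 'I_p])
    ((fun t : p.-tuple R => tnth t i) @^-1` A i)); last first.
  by apply/seteqP; split=> [t h i _|t h i]; [exact: h|exact: (h i I)].
apply: fin_bigcap_measurable => [|i _]; first exact: finite_finset.
by rewrite -[X in measurable X]setTI; exact: measurable_tnth.
Qed.

(** Boxes are stable under intersection, so by this lemma they determine a
    probability on tuples. *)
Lemma sigma_box (R : realType) p :
  (measurable : set (set (p.-tuple R))) =
  <<s [set B | exists2 A : 'I_p -> set R, (forall i, measurable (A i)) & B = box A] >>.
Proof.
apply/seteqP; split.
  apply: smallest_sub; first exact: smallest_sigma_algebra.
  rewrite -bigcup_seq/= => X [i /= _ [B mB <-]].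
  apply: sub_sigma_algebra; exists (fun j => if j == i then B else setT).
    by move=> j; case: ifP.
  apply/seteqP; split=> [t [_ Bt] j|t /(_ i)]; last by rewrite eqxx; split.
  by case: eqP => // ->.
apply: smallest_sub; first exact: sigma_algebra_measurable.
by move=> X [A mA ->]; exact: measurable_box.
Qed.

Lemma tuple_law_unique (R : realType) p (m1 m2 : probability (p.-tuple R) R) :
  (forall A : 'I_p -> set R, (forall i, measurable (A i)) ->
    m1 (box A) = m2 (box A)) ->
  forall X, measurable X -> m1 X = m2 X.
Proof.
move=> m12; apply: (measure_unique _ (fun=> setT) (sigma_box R p)).
- move=> X Y [A mA ->] [B mB ->]; exists (fun i => A i `&` B i).
    by move=> i; exact: measurableI.
  by apply/seteqP; split=> [t [h1 h2] i|t h]; [split|split=> i; have [] := h i].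
- by move=> _; exists (fun=> setT) => //; apply/seteqP; split.
- by rewrite bigcup_const//; exists 0.
- by move=> X [A mA ->]; exact: m12.
- by move=> _; rewrite (le_lt_trans (probability_le1 _ _)) ?ltry.
Qed.

Lemma prod_law_box (R : realType) p (Q : 'I_p -> probability R R)
    (A : 'I_p -> set R) : (forall i, measurable (A i)) ->
  prod_law Q (box A) = (\prod_(i < p) Q i (A i))%E.
Proof.
elim: p Q A => [|p IH] Q A mA.
  rewrite big_ord0 /= diracE mem_set//; by case.
rewrite big_ord_recl /=.
rewrite /distribution /pushforward.
rewrite (_ : _ @^-1` _ = A ord0 `*` box (fun i => A (lift ord0 i))).
  rewrite product_measure1E//; last by apply: measurable_box.
  by congr (_ * _)%E; exact: IH.
apply/seteqP; split=> [[x t] /= h|[x t] /= [hx ht] i].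
  split; first exact: (h ord0).
  by move=> i; have := h (lift ord0 i); rewrite tnthS.
by case: (unliftP ord0 i) => [j ->|->//]; rewrite tnthS; exact: ht.
Qed.

Lemma measurable_mktuple (R : realType) p (phi : 'I_p -> R -> R) :
  (forall i, measurable_fun setT (phi i)) ->
  measurable_fun setT
    (fun t : p.-tuple R => [tuple phi i (tnth t i) | i < p] : p.-tuple R).
Proof.
move=> mphi; apply/measurable_fun_tnthP => i.
rewrite (_ : _ \o _ = phi i \o (fun t : p.-tuple R => tnth t i)).
  by apply: measurableT_comp => //; exact: measurable_tnth.
by apply/funext => t /=; rewrite tnth_mktuple.
Qed.

(** Induction on the length: a tuple is the pair of its head and its tail, so the
    step is [transports_prod]. *)
Lemma transports_prod_law (R : realType) p (Q Q' : 'I_p -> probability R R)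
    (phi rho : 'I_p -> R -> R) :
  (forall i, transports (Q i) (Q' i) (phi i) (rho i)) ->
  transports (prod_law Q) (prod_law Q')
    (fun t => [tuple phi i (tnth t i) | i < p])
    (fun t => \prod_(i < p) rho i (tnth t i)).
Proof.
elim: p Q Q' phi rho => [|p IH] Q Q' phi rho H.
  split.
  - by apply: measurable_mktuple; case.
  - by rewrite (_ : (fun _ => _) = cst 1)//; apply/funext => t; rewrite big_ord0.
  - by move=> t; rewrite big_ord0.
  - move=> g mg g0; apply: eq_integral => t _.
    by rewrite big_ord0 mule1; congr g; rewrite tuple0 [RHS]tuple0.
have mphi : measurable_fun setT
    (fun t : p.+1.-tuple R => [tuple phi i (tnth t i) | i < p.+1] : p.+1.-tuple R).
  by apply: measurable_mktuple => i; case: (H i).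
have mrho : measurable_fun setT
    (fun t : p.+1.-tuple R => \prod_(i < p.+1) rho i (tnth t i)).
  apply: measurable_prod => i _.
  by apply: measurableT_comp; [case: (H i) | exact: measurable_tnth].
split => //.
  by move=> t; apply: prodr_ge0 => i _; case: (H i).
move=> g mg g0 /=.
rewrite ge0_integral_distribution//; last exact: measurableT_comp.
rewrite ge0_integral_distribution//; last 2 first.
- by apply: emeasurable_funM => //; exact/measurable_EFinP.
- move=> y; rewrite mule_ge0// lee_fin; apply: prodr_ge0 => i _.
  by case: (H i).
have [_ _ _] := transports_prod (H ord0) (IH _ _ _ _ (fun i => H (lift ord0 i))).
move=> /(_ (g \o @tcons R p)).
move=> /(_ (measurableT_comp mg (@measurable_tcons R p)) (fun=> g0 _)) E.
rewrite [RHS](_ : _ = \int[Q' ord0 \x prod_law (fun i => Q' (lift ord0 i))]_z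
    ((g \o @tcons R p) z *
     (rho ord0 z.1 * \prod_(i < p) rho (lift ord0 i) (tnth z.2 i))%:E))%E.
  rewrite -{}E; apply: eq_integral => -[x t] _ /=; congr g.
  apply: eq_from_tnth => i; rewrite tnth_mktuple.
  by case: (unliftP ord0 i) => [j ->|->//]; rewrite /tcons/= !tnthS tnth_mktuple.
apply: eq_integral => -[x t] _ /=; rewrite big_ord_recl/= /tcons/=.
by under eq_bigr do rewrite tnthS.
Qed.

(** * Affine changes of variable on the line *)

(** Lebesgue measure is characterised by the lengths of half-open intervals,
    whose preimages are intervals, reversed when a < 0. *)
Lemma lebesgue_affine_preimage (R : realType) (a b : R) (X : set R) :
  a != 0 -> measurable X ->
  lebesgue_measure X =
  (`|a|%:E * lebesgue_measure ((fun x => (a * x + b)%R) @^-1` X))%E.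
Proof.
move=> a0 mX.
have mphi : measurable_fun setT (fun x : R => a * x + b).
  by apply: measurable_funD => //; exact: measurable_funM.
pose phi (x : measurableTypeR R) : measurableTypeR R := a * x + b.
have H := @lebesgue_measure_unique R (mscale (NngNum (normr_ge0 a))
  (pushforward lebesgue_measure phi)).
apply: (H mphi) => // _ [[x y] _ <-] {H}.
transitivity (`|a|%:E * lebesgue_measure (phi @^-1` `]x, y]))%E; last by [].
case: (ltgtP a 0) a0 => // a0 _.
- rewrite (_ : phi @^-1` _ = `[(y - b) / a, (x - b) / a[%classic); last first.
    apply/seteqP; split=> z /=; rewrite /phi !in_itv/= => /andP[h1 h2]; apply/andP.
      by rewrite ler_ndivrMr// ltr_ndivlMr// [z * a]mulrC; split; lra.
    by move: h1 h2; rewrite ler_ndivrMr// ltr_ndivlMr// [z * a]mulrC; split; lra.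
  rewrite !lebesgue_measure_itv/= !lte_fin ltr_nM2r ?invr_lt0// ltrD2r.
  case: ifP => _; last by rewrite mule0.
  rewrite ltr0_norm// -!EFinB -EFinM; congr EFin; field; lra.
- rewrite (_ : phi @^-1` _ = `](x - b) / a, (y - b) / a]%classic); last first.
    apply/seteqP; split=> z /=; rewrite /phi !in_itv/= => /andP[h1 h2]; apply/andP.
      by rewrite ltr_pdivrMr// ler_pdivlMr// [z * a]mulrC; split; lra.
    by move: h1 h2; rewrite ltr_pdivrMr// ler_pdivlMr// [z * a]mulrC; split; lra.
  rewrite !lebesgue_measure_itv/= !lte_fin ltr_pM2r ?invr_gt0// ltrD2r.
  case: ifP => _; last by rewrite mule0.
  rewrite gtr0_norm// -!EFinB -EFinM; congr EFin; field; lra.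
Qed.

Lemma integral_lebesgue_affine (R : realType) (a b : R) (g : R -> \bar R) :
  a != 0 -> measurable_fun setT g -> (forall x, (0 <= g x)%E) ->
  (\int[lebesgue_measure]_x g x =
   \int[lebesgue_measure]_x (g (a * x + b)%R * `|a|%:E))%E.
Proof.
move=> a0 mg g0.
have mphi : measurable_fun setT (fun x : R => a * x + b).
  by apply: measurable_funD => //; exact: measurable_funM.
pose phi (x : measurableTypeR R) : measurableTypeR R := a * x + b.
rewrite ge0_integralZr//; last exact: measurableT_comp.
have E := @ge0_integral_pushforward _ _ _ _ _ phi mphi lebesgue_measure setT g.
rewrite [in RHS](_ : (fun x => g (a * x + b)%R) = g \o phi)//.
rewrite -{}E// muleC.
have -> : `|a|%:E = (NngNum (normr_ge0 a))%:num%:E by [].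
rewrite -ge0_integral_mscale//.
by apply: eq_measure_integral => // X mX _; exact: lebesgue_affine_preimage.
Qed.

(** f agrees almost everywhere with the Radon-Nikodym derivative of nu, for which
    the change of density is known. *)
Lemma integral_density (R : realType) (nu : probability R R) (f : R -> R)
    (g : R -> \bar R) :
  measurable_fun setT f -> (forall x, 0 <= f x) ->
  (forall A, measurable A -> nu A = (\int[lebesgue_measure]_(x in A) (f x)%:E)%E) ->
  measurable_fun setT g -> (forall x, 0 <= g x)%E ->
  (\int[nu]_x g x = \int[lebesgue_measure]_x (g x * (f x)%:E))%E.
Proof.
move=> mf f0 nuf mg g0.
have mEf : measurable_fun setT (EFin \o f) by exact/measurable_EFinP.
(* Lebesgue measure lives on measurableTypeR R, a copy of R with the same
   measurable sets, to which nu has to be moved. *)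
have mid : measurable_fun setT (fun x : R => x : measurableTypeR R).
  exact: measurable_id.
pose iota : {mfun R >-> measurableTypeR R} := HB.pack (fun x : R => x : measurableTypeR R)
  (isMeasurableFun.Build _ _ R (measurableTypeR R) _ mid).
pose nu' : probability (measurableTypeR R) R := distribution nu iota.
have nu'E A : measurable A -> nu' A = (\int[lebesgue_measure]_(x in A) (f x)%:E)%E.
  by move=> mA; exact: nuf.
have dom : nu' `<< lebesgue_measure.
  apply/null_content_dominatesP => A mA A0; rewrite [LHS]nu'E//.
  by apply: null_set_integral => //; exact: measurable_funTS.
transitivity (\int[nu']_x g x)%E; first by rewrite ge0_integral_distribution.
rewrite -(Radon_Nikodym_SigmaFinite.change_of_variables dom)//.
have mRN := measurable_int _ (Radon_Nikodym_SigmaFinite.f_integrable dom).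
apply: ge0_ae_eq_integral => //.
- exact: emeasurable_funM.
- exact: emeasurable_funM.
- by move=> x _; rewrite mule_ge0// Radon_Nikodym_SigmaFinite.f_ge0.
- by move=> x _; rewrite mule_ge0// lee_fin.
- apply: ae_eqe_mul2l.
  apply: integral_ae_eq => //; first exact: Radon_Nikodym_SigmaFinite.f_integrable.
  by move=> E _ mE; rewrite -Radon_Nikodym_SigmaFinite.f_integral//; exact: nu'E.
Qed.

(** All the one-dimensional changes of law below are affine maps between laws
    with a density; only the identity between the densities varies. *)
Lemma transports_affine (R : realType) (nu mu : probability R R) (f f' : R -> R)
    (a b : R) (rho : R -> R) :
  measurable_fun setT f -> (forall x, 0 <= f x) ->
  (forall A, measurable A -> nu A = (\int[lebesgue_measure]_(x in A) (f x)%:E)%E) ->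
  measurable_fun setT f' -> (forall x, 0 <= f' x) ->
  (forall A, measurable A -> mu A = (\int[lebesgue_measure]_(x in A) (f' x)%:E)%E) ->
  measurable_fun setT rho -> (forall x, 0 <= rho x) ->
  a != 0 ->
  (forall x, f x = `|a| * (rho (a * x + b) * f' (a * x + b))) ->
  transports nu mu (fun x => a * x + b) rho.
Proof.
move=> mf f0 nuf mf' f'0 muf' mrho rho0 a0 ff'.
have mphi : measurable_fun setT (fun x : R => a * x + b).
  by apply: measurable_funD => //; exact: measurable_funM.
split => // g mg g0.
rewrite (integral_density mf f0 nuf)//; last exact: measurableT_comp.
have mgr : measurable_fun setT (fun x => g x * (rho x)%:E)%E.
  by apply: emeasurable_funM => //; exact/measurable_EFinP.
have gr0 x : (0 <= g x * (rho x)%:E)%E by rewrite mule_ge0// lee_fin.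
rewrite (integral_density mf' f'0 muf')//.
have mgrf : measurable_fun setT (fun x => g x * (rho x)%:E * (f' x)%:E)%E.
  by apply: emeasurable_funM => //; exact/measurable_EFinP.
rewrite (integral_lebesgue_affine b a0 mgrf); last first.
  by move=> x; rewrite mule_ge0// lee_fin.
apply: eq_integral => x _; rewrite ff' -!muleA -!EFinM; congr (_ * _%:E)%E; ring.
Qed.

(** * Normal and chi-square laws *)

(** The normal laws are defined on measurableTypeR R, whereas the coordinates of
    tuples live in R; the two have the same measurable sets. *)
Definition borel_id (R : realType) (x : measurableTypeR R) : R := x.

Lemma measurable_borel_id (R : realType) : measurable_fun setT (@borel_id R).
Proof. exact: measurable_id. Qed.

HB.instance Definition _ (R : realType) :=
  isMeasurableFun.Build _ _ _ _ (@borel_id R) (@measurable_borel_id R).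

Definition normal_law (R : realType) (m v : R) : probability R R :=
  distribution (normal_prob m (Num.sqrt v)) (@borel_id R).

Lemma normal_pdf_varE (R : realType) (m v x : R) : 0 < v ->
  normal_pdf m (Num.sqrt v) x =
  normal_peak (Num.sqrt v) * expR (- (x - m) ^+ 2 / (v * 2)).
Proof.
move=> v0; rewrite normal_pdfE ?gt_eqF ?sqrtr_gt0//.
by rewrite /normal_fun sqr_sqrtr ?ltW// mulr_natr.
Qed.

Lemma normal_transports_affine (R : realType) (m m' v a b : R) (rho : R -> R) :
  0 < v -> measurable_fun setT rho -> (forall x, 0 <= rho x) -> a != 0 ->
  (forall x, expR (- (x - m) ^+ 2 / (v * 2)) =
    `|a| * (rho (a * x + b) * expR (- (a * x + b - m') ^+ 2 / (v * 2)))) ->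
  transports (normal_law m v) (normal_law m' v) (fun x => a * x + b) rho.
Proof.
move=> v0 mrho rho0 a0 H.
apply: (@transports_affine _ _ _ (normal_pdf m (Num.sqrt v))
  (normal_pdf m' (Num.sqrt v))) => //.
- exact: measurable_normal_pdf.
- by move=> x; exact: normal_pdf_ge0.
- exact: measurable_normal_pdf.
- by move=> x; exact: normal_pdf_ge0.
- move=> x; rewrite !normal_pdf_varE// H; ring.
Qed.

Lemma normal_transports_center (R : realType) (m v : R) : 0 < v ->
  transports (normal_law m v) (normal_law 0 v) id
    (fun x => expR (x * m / v - m ^+ 2 / (v * 2))).
Proof.
move=> v0; rewrite (_ : id = fun x => 1 * x + 0); last first.
  by apply/funext => x; rewrite mul1r addr0.
apply: normal_transports_affine => //.
- apply: measurableT_comp => //; apply: measurable_funB => //.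
  by apply: measurable_funM => //; apply: measurable_funM.
- move=> x; rewrite normr1 mul1r -expRD; congr expR; field; lra.
Qed.

Lemma normal_transports_reflect (R : realType) (m v : R) : 0 < v ->
  transports (normal_law m v) (normal_law m v) (fun x => 2 * m - x) (cst 1).
Proof.
move=> v0; rewrite (_ : (fun x => 2 * m - x) = fun x => -1 * x + 2 * m); last first.
  by apply/funext => x; ring.
apply: normal_transports_affine => //.
move=> x; rewrite normrN normr1 !mul1r; congr expR; field; lra.
Qed.

Lemma normal_transports_scale (R : realType) (c v : R) : 0 < v -> 0 < c ->
  transports (normal_law 0 v) (normal_law 0 v) ( *%R c)
    (fun x => c^-1 * expR (- ((c ^- 2 - 1) / 2 * (x ^+ 2 / v)))).
Proof.
move=> v0 c0; rewrite (_ : *%R c = fun x => c * x + 0); last first.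
  by apply/funext => x; rewrite addr0.
apply: normal_transports_affine => //.
- apply: measurable_funM => //; apply: measurableT_comp => //.
  apply: measurableT_comp => //; apply: measurable_funM => //.
  by apply: measurable_funM => //; exact: measurable_funX.
- by move=> x; rewrite mulr_ge0 ?expR_ge0// invr_ge0 ltW.
- by rewrite gt_eqF.
- move=> x; rewrite gtr0_norm// [RHS]mulrA [in RHS]mulrA divff ?gt_eqF// mul1r -expRD.
  congr expR; field; apply/andP; split; lra.
Qed.

Lemma chi2_pdf_ge0 (R : realType) (k : nat) (x : R) : 0 <= chi2_pdf k x.
Proof.
rewrite /chi2_pdf; case: ifP => // x0.
rewrite divr_ge0 ?mulr_ge0 ?powR_ge0 ?expR_ge0//.
apply: Rintegral_ge0 => t _; by rewrite mulr_ge0 ?powR_ge0 ?expR_ge0.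
Qed.

Lemma measurable_chi2_pdf (R : realType) (k : nat) :
  measurable_fun setT (@chi2_pdf R k).
Proof.
apply: measurable_fun_ifT => //; first exact: measurable_fun_ltr.
apply: measurable_funM => //; apply: measurable_funM; first exact: measurable_powR.
by apply: measurableT_comp => //; apply: measurableT_comp => //; exact: measurable_funM.
Qed.

(** The norming constant of the density, being the same on both sides, cancels. *)
Lemma chi2_transports_scale (R : realType) (k : nat) (Q : probability R R) (c : R) :
  (forall A, measurable A -> Q A = chi2_prob k A) -> 0 < c ->
  transports Q Q ( *%R (c ^+ 2))
    (fun x => c ^- k * expR (- ((c ^- 2 - 1) / 2 * x))).
Proof.
move=> QE c0; rewrite (_ : *%R (c ^+ 2) = fun x => c ^+ 2 * x + 0); last first.
  by apply/funext => x; rewrite addr0.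
have c20 : 0 < c ^+ 2 by rewrite exprn_gt0.
apply: (@transports_affine _ _ _ (chi2_pdf k) (chi2_pdf k)) => //.
- exact: measurable_chi2_pdf.
- exact: chi2_pdf_ge0.
- exact: measurable_chi2_pdf.
- exact: chi2_pdf_ge0.
- apply: measurable_funM => //; apply: measurableT_comp => //.
  by apply: measurableT_comp => //; exact: measurable_funM.
- by move=> x; rewrite mulr_ge0 ?expR_ge0// invr_ge0 exprn_ge0 ?ltW.
- by rewrite gt_eqF.
move=> x; rewrite addr0 gtr0_norm// /chi2_pdf pmulr_rgt0//.
case: ifP => x0; last by rewrite !mulr0.
set K := 2 `^ _ * _.
have -> : (c ^+ 2 * x) `^ (k%:R / 2 - 1) = c ^+ k / c ^+ 2 * x `^ (k%:R / 2 - 1).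
  rewrite powRM ?ltW//; congr (_ * _).
  rewrite -powR_mulrn ?ltW// -powRrM mulrBr mulr1 mulrCA divff// mulr1.
  by rewrite powRB ?(gt_eqF c0) ?implybT//= !powR_mulrn ?ltW.
have -> : expR (- (x / 2)) =
    expR (- ((c ^- 2 - 1) / 2 * (c ^+ 2 * x))) * expR (- (c ^+ 2 * x / 2)).
  by rewrite -expRD; congr expR; field; lra.
have ck : c ^+ k != 0 by rewrite expf_neq0// gt_eqF.
rewrite -[_ ^- k]/((c ^+ k)^-1); move: (c ^+ k) ck (K^-1) => C C0 K'.
field; rewrite C0; lra.
Qed.

(** * A hyperbolic inequality along rays *)

Definition cosh (R : realType) (x : R) : R := (expR x + expR (- x)) / 2.
Definition sinh (R : realType) (x : R) : R := (expR x - expR (- x)) / 2.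

Global Instance is_derive_sinh (R : realType) (x : R) : is_derive x 1 (@sinh R) (cosh x).
Proof.
rewrite /sinh /cosh; apply: is_derive_eq.
by rewrite /GRing.scale/=; ring.
Qed.

Global Instance is_derive_cosh (R : realType) (x : R) : is_derive x 1 (@cosh R) (sinh x).
Proof.
rewrite /sinh /cosh; apply: is_derive_eq.
by rewrite /GRing.scale/=; ring.
Qed.

Lemma cosh_ge0 (R : realType) (x : R) : 0 <= cosh x.
Proof. by rewrite divr_ge0// addr_ge0// expR_ge0. Qed.

Lemma coshN (R : realType) (x : R) : cosh (- x) = cosh x.
Proof. by rewrite /cosh opprK addrC. Qed.

Lemma sinhN (R : realType) (x : R) : sinh (- x) = - sinh x.
Proof. by rewrite /sinh opprK; lra. Qed.

Lemma sinh0 (R : realType) : sinh (0 : R) = 0.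
Proof. by rewrite /sinh oppr0 subrr mul0r. Qed.

Lemma sinh_ge0 (R : realType) (x : R) : 0 <= x -> 0 <= sinh x.
Proof. by move=> x0; rewrite divr_ge0// subr_ge0 ler_expR; lra. Qed.

(** The difference vanishes at 0 and has derivative x sinh x. *)
Lemma sinh_le_mul_cosh (R : realType) (x : R) : 0 <= x -> sinh x <= x * cosh x.
Proof.
move=> x0; pose f (y : R) := y * cosh y - sinh y.
have df (y : R) : is_derive y 1 f (y * sinh y).
  by rewrite /f; apply: is_derive_eq; rewrite /GRing.scale/=; ring.
suff : f 0 <= f x by rewrite /f mul0r sinh0 subrr subr_ge0.
apply: (@ger0_derive1_ndecry _ f 0) => //.
- move=> y; rewrite in_itv/= andbT => y0.
  by rewrite derive1E (@derive_val _ _ _ _ _ _ _ (df y)) mulr_ge0 ?sinh_ge0// ltW.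
- by apply: derivable_within_continuous => y _.
Qed.

Lemma mul_sinh_ge0 (R : realType) (x : R) : 0 <= x * sinh x.
Proof.
case: (leP 0 x) => x0; first by rewrite mulr_ge0// sinh_ge0.
by rewrite -mulrNN -sinhN mulr_ge0 ?sinh_ge0//; lra.
Qed.

Lemma mul_sinh_le (R : realType) (x : R) : x * sinh x <= x ^+ 2 * cosh x.
Proof.
suff H (y : R) : 0 <= y -> y * sinh y <= y ^+ 2 * cosh y.
  case: (leP 0 x) => x0; first exact: H.
  by rewrite -mulrNN -sinhN -sqrrN -coshN; apply: H; lra.
by move=> y0; rewrite expr2 -mulrA ler_wpM2l// sinh_le_mul_cosh.
Qed.

Global Instance is_derive_monomial (R : realType) (k : nat) (x : R) :
  is_derive x 1 (fun r : R => r ^+ k) (k%:R * x ^+ k.-1).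
Proof.
have H : is_derive x 1 ((id : R -> R) ^+ k) ((k%:R * x ^+ k.-1) *: (1 : R)).
  exact: is_deriveX.
have -> : (fun r : R => r ^+ k) = (id : R -> R) ^+ k.
  apply/funext => r; by rewrite exprfctE.
by move: H; rewrite /GRing.scale/= mulr1.
Qed.

Lemma is_derive_radial (R : realType) (a t x : R) (k : nat) :
  is_derive x 1
    (fun r : R => r ^+ k * (a * sinh (a * r)) * expR (- (t * r ^+ 2 / 2)))
    ((k%:R * x ^+ k.-1 * (a * sinh (a * x)) + x ^+ k * (a ^+ 2 * cosh (a * x))
      - t * x ^+ k.+1 * (a * sinh (a * x))) * expR (- (t * x ^+ 2 / 2))).
Proof.
apply: is_derive_eq; rewrite /GRing.scale/= (exprS x k); field => //.
Qed.

Lemma derivable1_continuous (R : realType) (f : R -> R) :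
  (forall x, derivable f x 1) -> continuous f.
Proof.
by move=> df x; apply: differentiable_continuous; rewrite -derivable1_diffP.
Qed.

(** By the fundamental theorem of calculus for
    F x = x^k a sinh(a x) e^(-t x^2/2), which is nonnegative on [0, b] and
    vanishes at 0 (also for k = 0, thanks to sinh). Its derivative is the second
    integrand minus the first, minus
    k x^(k-1) a (a x cosh(a x) - sinh(a x)) e^(-t x^2/2), which is nonnegative. *)
Lemma radial_sinh_le_cosh_bounded (R : realType) (a t b : R) (k : nat) : 0 < b ->
  (\int[lebesgue_measure]_(x in `[0%R, b])
     (t * x ^+ k.+1 * (a * sinh (a * x)) * expR (- (t * x ^+ 2 / 2)))%:E <=
   \int[lebesgue_measure]_(x in `[0%R, b])
     (k.+1%:R * x ^+ k * (a ^+ 2 * cosh (a * x)) * expR (- (t * x ^+ 2 / 2)))%:E)%E.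
Proof.
move=> b0.
set al := fun x : R => t * x ^+ k.+1 * (a * sinh (a * x)) * expR (- (t * x ^+ 2 / 2)).
set be := fun x : R => k.+1%:R * x ^+ k * (a ^+ 2 * cosh (a * x)) * expR (- (t * x ^+ 2 / 2)).
pose F := fun x : R => x ^+ k * (a * sinh (a * x)) * expR (- (t * x ^+ 2 / 2)).
pose f := fun x : R => (k%:R * x ^+ k.-1 * (a * sinh (a * x)) + x ^+ k * (a ^+ 2 * cosh (a * x))
      - t * x ^+ k.+1 * (a * sinh (a * x))) * expR (- (t * x ^+ 2 / 2)).
have dF (x : R) : is_derive x 1 F (f x) by exact: is_derive_radial.
have cF : continuous F by apply: derivable1_continuous => x.
have cf : continuous f.
  by apply: derivable1_continuous => x; rewrite /f.
have cal : continuous al by apply: derivable1_continuous => x; rewrite /al.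
have cbe : continuous be by apply: derivable1_continuous => x; rewrite /be.
have int (g : R -> R) : continuous g ->
    lebesgue_measure.-integrable `[0, b] (EFin \o g).
  move=> cg; apply: continuous_compact_integrable; first exact: segment_compact.
  exact: continuous_subspaceT.
have FTC : (\int[lebesgue_measure]_(x in `[0%R, b]) (f x)%:E = (F b)%:E - (F 0)%:E)%E.
  apply: continuous_FTC2 => //; first exact: continuous_subspaceT.
  - split => //; first by apply: cvg_at_right_filter; exact: cF.
    by apply: cvg_at_left_filter; exact: cF.
  - by move=> x _; rewrite derive1E (@derive_val _ _ _ _ _ _ _ (dF x)).
have Fb : (0 <= (F b)%:E - (F 0)%:E)%E.
  rewrite -EFinB lee_fin /F mulr0 sinh0 !mulr0 mul0r subr0.
  rewrite mulr_ge0 ?expR_ge0// mulr_ge0 ?exprn_ge0 ?(ltW b0)//.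
  by rewrite -(pmulr_rge0 _ b0) mulrA (mulrC b); exact: mul_sinh_ge0.
apply: (@le_trans _ _ (\int[lebesgue_measure]_(x in `[0%R, b]) ((al x)%:E + (f x)%:E))%E).
  rewrite integralD//=; [|exact: int|exact: int].
  by rewrite FTC leeDl.
apply: le_integral => //.
- by apply: integrableD => //; exact: int.
- exact: int.
- move=> x; rewrite inE/= in_itv/= => /andP[x0 _].
  rewrite -EFinD lee_fin /al /f /be -!mulrDl; apply: ler_wpM2r; first exact: expR_ge0.
  rewrite [X in X <= _](_ : _ = k%:R * x ^+ k.-1 * (a * sinh (a * x)) +
    x ^+ k * (a ^+ 2 * cosh (a * x))); last by ring.
  rewrite [X in _ <= X](_ : _ = k%:R * x ^+ k * (a ^+ 2 * cosh (a * x)) +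
    x ^+ k * (a ^+ 2 * cosh (a * x))); last by rewrite -natr1; ring.
  rewrite lerD2r; case: (k) => [|k'] /=; first by rewrite !mul0r.
  rewrite -!mulrA ler_wpM2l// exprSr -mulrA ler_wpM2l ?exprn_ge0//.
  move: x0; rewrite le_eqVlt => /predU1P[<-|x0].
    by rewrite mulr0 sinh0 !mul0r mulr0.
  (* Multiplying by x turns the claim into y sinh y <= y^2 cosh y at y = a x. *)
  rewrite -(ler_pM2l x0).
  have := mul_sinh_le (a * x); rewrite exprMn; lra.
Qed.

(** * Comparison of integrals ray by ray *)

Lemma integral_if_gt0 (R : realType) (f : R -> R) :
  (\int[lebesgue_measure]_x (if 0 < x then f x else 0)%:E =
   \int[lebesgue_measure]_(x in `]0%R, +oo[) (f x)%:E)%E.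
Proof.
rewrite [RHS]integral_mkcond; apply: eq_integral => x _.
rewrite patchE; case: ifPn => x0; first by rewrite mem_set//= in_itv/= x0.
by rewrite memNset//= in_itv/= andbT; apply/negP.
Qed.

(** The limit of the inequality on bounded intervals. The factor c and the test
    0 < x give it the form in which it arises along a ray. *)
Lemma radial_sinh_le_cosh (R : realType) (a t c : R) (k : nat) : 0 < t -> 0 <= c ->
  (\int[lebesgue_measure]_x (if 0 < x then
     c * (t * x ^+ k.+1 * (a * sinh (a * x)) * expR (- (t * x ^+ 2 / 2))) else 0)%:E <=
   \int[lebesgue_measure]_x (if 0 < x then
     c * (k.+1%:R * x ^+ k * (a ^+ 2 * cosh (a * x)) * expR (- (t * x ^+ 2 / 2))) else 0)%:E)%E.
Proof.
move=> t0 c0; rewrite !integral_if_gt0.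
set al := fun x : R => t * x ^+ k.+1 * (a * sinh (a * x)) * expR (- (t * x ^+ 2 / 2)).
set be := fun x : R => k.+1%:R * x ^+ k * (a ^+ 2 * cosh (a * x)) * expR (- (t * x ^+ 2 / 2)).
have cal : continuous al by apply: derivable1_continuous => x; rewrite /al.
have cbe : continuous be by apply: derivable1_continuous => x; rewrite /be.
have mal : measurable_fun setT (EFin \o al).
  by apply/measurable_EFinP; exact: continuous_measurable_fun.
have mbe : measurable_fun setT (EFin \o be).
  by apply/measurable_EFinP; exact: continuous_measurable_fun.
have al0 x : 0 <= x -> 0 <= al x.
  move=> x0; rewrite /al mulr_ge0 ?expR_ge0// exprS.
  rewrite [X in 0 <= X](_ : _ = t * x ^+ k * (a * x * sinh (a * x))); last by ring.
  by rewrite mulr_ge0 ?mul_sinh_ge0// mulr_ge0 ?exprn_ge0// ltW.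
have be0 x : 0 <= x -> 0 <= be x.
  move=> x0; rewrite /be mulr_ge0 ?expR_ge0//.
  by apply: mulr_ge0; [rewrite mulr_ge0 ?exprn_ge0|rewrite mulr_ge0 ?sqr_ge0 ?cosh_ge0].
under eq_integral do rewrite EFinM.
under [leRHS]eq_integral do rewrite EFinM.
have pos (f : R -> R) : (forall x, 0 <= x -> 0 <= f x) ->
    forall x, `]0%R, +oo[%classic x -> (0 <= (f x)%:E)%E.
  by move=> f0 x; rewrite /= in_itv/= andbT lee_fin => /ltW; exact: f0.
rewrite !ge0_integralZl//; [|exact: measurable_funTS|exact: pos
  |exact: measurable_funTS|exact: pos].
rewrite lee_wpmul2l ?lee_fin//.
pose I n := `[0%R, n%:R]%classic : set R.
have bigI : \bigcup_n I n = `[0%R, +oo[%classic.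
  apply/seteqP; split=> [x [n _]|x]; rewrite /I/= !in_itv/= ?andbT.
    by move=> /andP[].
  move=> x0; exists (Num.truncn x).+1 => //=.
  by rewrite in_itv/= x0 ltW// truncnS_gt.
have lim (f : R -> R) : measurable_fun setT (EFin \o f) ->
    (forall x, 0 <= x -> 0 <= f x) ->
    (\int[lebesgue_measure]_(x in I n) (f x)%:E @[n --> \oo] -->
     \int[lebesgue_measure]_(x in `]0%R, +oo[) (f x)%:E)%E.
  move=> mf f0; rewrite integral_itv_obnd_cbnd; last exact: measurable_funTS.
  rewrite -bigI; apply: ge0_nondecreasing_set_cvg_integral.
  - move=> n m nm; apply/subsetPset => x; rewrite /I/= !in_itv/= => /andP[-> h].
    by rewrite (le_trans h)// ler_nat.
  - by move=> n; exact: measurable_itv.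
  - by move=> n; exact: measurable_funTS.
  - by move=> n x; rewrite /I/= in_itv/= lee_fin => /andP[+ _]; exact: f0.
apply: (lee_cvg_to (lim al mal al0) (lim be mbe be0)).
exists 1%N => // n /= n0; apply: radial_sinh_le_cosh_bounded.
by rewrite ltr0n.
Qed.

Lemma measurable_invr (R : realType) : measurable_fun setT (@GRing.inv R).
Proof.
have m0 : measurable [set (0 : R)] by [].
rewrite -(setvU [set (0 : R)]).
apply/(measurable_funU _ (measurableC m0) m0); split; last exact: measurable_fun_set1.
apply: open_continuous_measurable_fun; first exact/closed_openC/closed_eq.
by move=> x /[!inE]/= x0; apply: inv_continuous; apply/eqP.
Qed.

Lemma measurable_sqrtr (R : realType) : measurable_fun setT (@Num.sqrt R).
Proof. by apply: continuous_measurable_fun; exact: sqrt_continuous. Qed.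

(** Polar coordinates for a family of dilations, without a measure on the set of
    rays. For homogeneity of degree n.+1 of the measure e^(T/2) M, the number 1
    is written as the integral over r of [annulus y r], integrations are
    exchanged, y is replaced by [dil r y], and integrations are exchanged back:
    the integral over r then runs along the ray through y. *)
Section radial_comparison.
Context (R : realType) d (Y : measurableType d) (M : probability Y R).
Variables (T : Y -> R) (dil : R -> Y -> Y) (n : nat).
Hypothesis mT : measurable_fun setT T.
Hypothesis mdil : measurable_fun setT (fun z : Y * R => dil z.2 z.1).
Hypothesis T_dil : forall r y, T (dil r y) = r ^+ 2 * T y.
Hypothesis M_dil : forall r : R, 0 < r -> transports M M (dil r)
  (fun y => r ^- n.+1 * expR (- ((r ^- 2 - 1) / 2 * T y))).

(** [M_dil] read backwards: the density is moved to the other side. *)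
Lemma integral_dilation (r : R) (G : Y -> R) : 0 < r ->
  measurable_fun setT G -> (forall y, 0 <= G y) ->
  (\int[M]_y (G y)%:E =
   \int[M]_y (r ^+ n.+1 * expR ((1 - r ^+ 2) / 2 * T y) * G (dil r y))%:E)%E.
Proof.
move=> r0 mG G0; have [mphi _ _ H] := M_dil r0.
have rn0 : r ^+ n.+1 != 0 by rewrite expf_neq0// gt_eqF.
pose g y := r ^+ n.+1 * expR ((r ^- 2 - 1) / 2 * T y) * G y.
have mg : measurable_fun setT (EFin \o g).
  apply/measurable_EFinP; apply: measurable_funM => //.
  apply: measurable_funM => //; apply: measurableT_comp => //.
  exact: measurable_funM.
have g0 y : 0 <= g y by rewrite !mulr_ge0 ?expR_ge0// exprn_ge0// ltW.
transitivity (\int[M]_y (EFin \o g) (dil r y))%E.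
  rewrite H//.
  apply: eq_integral => y _; rewrite /= -EFinM; congr EFin; rewrite /g.
  rewrite expRN -[_ ^- n.+1]/((r ^+ n.+1)^-1).
  by field; rewrite rn0 gt_eqF ?expR_gt0.
apply: eq_integral => y _; rewrite /= /g T_dil; congr (_ * expR _ * _)%:E.
by field; rewrite gt_eqF.
Qed.

(** The uniform density on the interval of the r with s < r < 2 s, where s is the
    square root of T y. *)
Definition annulus (y : Y) (r : R) : R :=
  if [&& 0 < r, T y < r ^+ 2 & r ^+ 2 < 4 * T y] then (Num.sqrt (T y))^-1 else 0.

Lemma integral_annulus y : 0 < T y ->
  (\int[lebesgue_measure]_r (annulus y r)%:E = 1)%E.
Proof.
move=> T0; set s : R := Num.sqrt (T y).
have s0 : 0 < s by rewrite sqrtr_gt0.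
have Ts : T y = s ^+ 2 by rewrite sqr_sqrtr// ltW.
transitivity (\int[lebesgue_measure]_(r in `]s, (2 * s)%R[) (s^-1)%:E)%E.
  rewrite [RHS]integral_mkcond; apply: eq_integral => r _.
  rewrite patchE /annulus -/s Ts.
  have -> : (r \in `]s, (2 * s)[%classic) = [&& 0 < r, s ^+ 2 < r ^+ 2 & r ^+ 2 < 4 * s ^+ 2].
    rewrite (_ : 4 * s ^+ 2 = (2 * s) ^+ 2); last by ring.
    case: (ltP 0 r) => r0 /=.
      rewrite !ltr_pXn2r ?nnegrE ?(ltW r0) ?(ltW s0) ?mulr_ge0 ?(ltW s0)//.
      by rewrite mem_setE in_itv.
    by rewrite mem_setE in_itv/=; apply/negbTE/negP => /andP[]; lra.
  by case: ifP.
rewrite integral_cst//= lebesgue_measure_itv/= lte_fin.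
rewrite ifT; last by lra.
rewrite -EFinB -EFinM; congr EFin; field; lra.
Qed.

Lemma annulus_ge0 y r : 0 <= annulus y r.
Proof. by rewrite /annulus; case: ifP => // _; rewrite invr_ge0 sqrtr_ge0. Qed.

Lemma measurable_annulus :
  measurable_fun setT (fun z : Y * R => annulus z.1 z.2).
Proof.
have mT1 : measurable_fun setT (fun z : Y * R => T z.1) by apply: measurableT_comp.
have mr2 : measurable_fun setT (fun z : Y * R => z.2 ^+ 2).
  by apply: measurable_funX.
apply: measurable_fun_ifT => //.
  apply: measurable_and; first exact: measurable_fun_ltr.
  apply: measurable_and; first exact: measurable_fun_ltr.
  by apply: measurable_fun_ltr => //; exact: measurable_funM.
apply: (measurableT_comp (@measurable_invr R)).
by apply: (measurableT_comp (@measurable_sqrtr R)) => //.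
Qed.

(** For T y > 0, the density of e^(T/2) M along the ray through y is r^n dr, and
    the factor e^(-T/2) at [dil r y] is the exponential below. *)
Definition ray (F : Y -> R) (y : Y) (r : R) : R :=
  if 0 < r then F (dil r y) * r ^+ n * expR (- (T y * r ^+ 2 / 2)) else 0.

(** The annulus condition at [dil r y] does not depend on r: it becomes a weight
    on y, bounded away from T y = 0, that selects a piece of each ray. *)
Definition ray_weight (y : Y) : R :=
  if (T y < 1) && (1 < 4 * T y) then expR (T y / 2) / Num.sqrt (T y) else 0.

Lemma ray_ge0 F y r : (forall y, 0 <= F y) -> 0 <= ray F y r.
Proof.
move=> F0; rewrite /ray; case: ifP => // r0.
by rewrite !mulr_ge0 ?expR_ge0// exprn_ge0// ltW.
Qed.

Lemma measurable_ray F : measurable_fun setT F ->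
  measurable_fun setT (fun z : Y * R => ray F z.1 z.2).
Proof.
move=> mF; apply: measurable_fun_ifT => //; first exact: measurable_fun_ltr.
apply: measurable_funM.
  apply: measurable_funM; first exact: (measurableT_comp mF mdil).
  exact: measurable_funX.
apply: measurableT_comp => //; apply: measurableT_comp => //.
apply: measurable_funM => //; apply: measurable_funM; first exact: measurableT_comp.
exact: measurable_funX.
Qed.

Lemma measurable_ray_weight : measurable_fun setT ray_weight.
Proof.
apply: measurable_fun_ifT => //.
  apply: measurable_and; apply: measurable_fun_ltr => //.
  exact: measurable_funM.
apply: measurable_funM.
  by apply: measurableT_comp => //; exact: measurable_funM.
apply: (measurableT_comp (@measurable_invr R)).
exact: (measurableT_comp (@measurable_sqrtr R)).
Qed.

Lemma ray_weight_ge0 y : 0 <= ray_weight y.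
Proof. by rewrite /ray_weight; case: ifP => // _; rewrite divr_ge0 ?expR_ge0 ?sqrtr_ge0. Qed.

(** The integrand after replacing y by [dil r y] splits into a factor depending
    on y alone and the integrand along the ray. *)
Lemma ray_annulus F y r :
  (if 0 < r then r ^+ n.+1 * expR ((1 - r ^+ 2) / 2 * T y) *
     (F (dil r y) * annulus (dil r y) r) else 0) =
  ray_weight y * ray F y r.
Proof.
rewrite /ray; case: ifPn => r0; last by rewrite mulr0.
have r20 : 0 < r ^+ 2 by rewrite exprn_gt0.
rewrite /annulus /ray_weight r0 T_dil/=.
have -> : (r ^+ 2 * T y < r ^+ 2) = (T y < 1).
  by rewrite -[X in _ < X]mulr1 ltr_pM2l.
have -> : (r ^+ 2 < 4 * (r ^+ 2 * T y)) = (1 < 4 * T y).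
  by rewrite -[X in X < _]mulr1 mulrCA ltr_pM2l.
case: ifPn => [/andP[_ T1]|_]; last by rewrite !mulr0 mul0r.
have T0 : 0 < T y by lra.
rewrite sqrtrM ?(ltW r20)// sqrtr_sqr gtr0_norm//.
have -> : expR ((1 - r ^+ 2) / 2 * T y) = expR (T y / 2) * expR (- (T y * r ^+ 2 / 2)).
  by rewrite -expRD; congr expR; field.
rewrite exprS; field.
by rewrite !gt_eqF// sqrtr_gt0.
Qed.

Lemma integral_polar (F : Y -> R) : measurable_fun setT F -> (forall y, 0 <= F y) ->
  (forall y, T y <= 0 -> F y = 0) ->
  (\int[M]_y (F y)%:E =
   \int[M]_y ((ray_weight y)%:E * \int[lebesgue_measure]_r (ray F y r)%:E))%E.
Proof.
move=> mF F0 FT.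
have mFa : measurable_fun setT (fun z : Y * R => (F z.1 * annulus z.1 z.2)%:E).
  apply/measurable_EFinP/measurable_funM; last exact: measurable_annulus.
  exact: measurableT_comp.
have Fa0 z : (0 <= (F z.1 * annulus z.1 z.2)%:E)%E.
  by rewrite lee_fin mulr_ge0// annulus_ge0.
have mray := measurable_ray mF.
have mw := measurable_ray_weight.
have mwr : measurable_fun setT
    (fun z : Y * R => (ray_weight z.1 * ray F z.1 z.2)%:E).
  by apply/measurable_EFinP/measurable_funM => //; exact: measurableT_comp.
have wr0 z : (0 <= (ray_weight z.1 * ray F z.1 z.2)%:E)%E.
  by rewrite lee_fin mulr_ge0 ?ray_weight_ge0 ?ray_ge0.
transitivity (\int[M]_y \int[lebesgue_measure]_r (F y * annulus y r)%:E)%E.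
  apply: eq_integral => y _.
  case: (leP (T y) 0) => T0.
    rewrite FT// integral0_eq// => r _; by rewrite mul0r.
  under eq_integral do rewrite EFinM.
  rewrite ge0_integralZl//=.
  - by rewrite integral_annulus// mule1.
  - by apply/measurable_EFinP; exact: (measurable_fun_pair2 _ measurable_annulus).
  - by move=> r _; rewrite lee_fin annulus_ge0.
  - by rewrite lee_fin.
have /= -> := @fubini_tonelli _ _ _ (measurableTypeR R) _ M lebesgue_measure
  (fun z : Y * R => (F z.1 * annulus z.1 z.2)%:E) mFa Fa0.
transitivity (\int[lebesgue_measure]_r \int[M]_y (ray_weight y * ray F y r)%:E)%E.
  apply: eq_integral => r _; case: (ltP 0 r) => r0.
    rewrite (@integral_dilation r (fun y => F y * annulus y r))//.
    - by apply: eq_integral => y _; rewrite -ray_annulus r0.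
    - by apply/measurable_EFinP; exact: (measurable_fun_pair1 _ mFa).
    - by move=> y; have := Fa0 (y, r); rewrite lee_fin.
  apply: eq_integral => y _; rewrite /annulus /ray !ifN ?mulr0// -?leNgt//.
  by rewrite negb_and -leNgt r0.
have /= <- := @fubini_tonelli _ _ _ (measurableTypeR R) _ M lebesgue_measure
  (fun z : Y * R => (ray_weight z.1 * ray F z.1 z.2)%:E) mwr wr0.
apply: eq_integral => y _.
under eq_integral do rewrite EFinM.
rewrite ge0_integralZl//=.
- by apply/measurable_EFinP; exact: (measurable_fun_pair2 _ mray).
- by move=> r _; rewrite lee_fin ray_ge0.
- by rewrite lee_fin ray_weight_ge0.
Qed.

Lemma le_integral_radial (A B : Y -> R) :
  measurable_fun setT A -> measurable_fun setT B ->
  (forall y, 0 <= A y) -> (forall y, 0 <= B y) ->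
  (forall y, T y <= 0 -> A y = 0) -> (forall y, T y <= 0 -> B y = 0) ->
  (forall y, 0 < T y -> (\int[lebesgue_measure]_r (ray A y r)%:E <=
     \int[lebesgue_measure]_r (ray B y r)%:E)%E) ->
  (\int[M]_y (A y)%:E <= \int[M]_y (B y)%:E)%E.
Proof.
move=> mA mB A0 B0 AT BT AB; rewrite !integral_polar//.
have mI (F : Y -> R) : measurable_fun setT F -> (forall y, 0 <= F y) ->
    measurable_fun setT (fun y => \int[lebesgue_measure]_r (ray F y r)%:E)%E.
  move=> mF F0.
  apply: (@measurable_fun_fubini_tonelli_F _ _ _ (measurableTypeR R) _
    lebesgue_measure (fun z : Y * R => (ray F z.1 z.2)%:E)).
    by apply/measurable_EFinP; exact: measurable_ray.
  by move=> z; rewrite lee_fin ray_ge0.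
apply: ge0_le_integral => //.
- by move=> y _; rewrite mule_ge0 ?lee_fin ?ray_weight_ge0// integral_ge0// => r _;
    rewrite lee_fin ray_ge0.
- by apply: emeasurable_funM; [exact/measurable_EFinP/measurable_ray_weight|exact: mI].
- by apply: emeasurable_funM; [exact/measurable_EFinP/measurable_ray_weight|exact: mI].
- move=> y _; case: (leP (T y) 0) => T0.
    rewrite /ray_weight ifF ?mul0e//; apply/negbTE/negP => /andP[_]; lra.
  by rewrite lee_wpmul2l ?lee_fin ?ray_weight_ge0// AB.
Qed.

End radial_comparison.

(** * The centred model *)

Lemma measurable_dot (R : realType) d (T : measurableType d) p
    (f g : T -> p.-tuple R) :
  measurable_fun setT f -> measurable_fun setT g ->
  measurable_fun setT (fun x => dot (f x) (g x)).
Proof.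
move=> mf mg; apply: measurable_sum => i.
by apply: measurable_funM;
  [apply: (measurableT_comp (measurable_tnth i) mf)
  |apply: (measurableT_comp (measurable_tnth i) mg)].
Qed.

Lemma dot_ge0 (R : realType) p (u : p.-tuple R) : 0 <= dot u u.
Proof. by apply: sumr_ge0 => i _; rewrite -expr2 sqr_ge0. Qed.

Lemma enorm_sqr (R : realType) p (u : p.-tuple R) : enorm u ^+ 2 = dot u u.
Proof. by rewrite sqr_sqrtr// dot_ge0. Qed.

Lemma dot_scalel (R : realType) p (a : R) (u v : p.-tuple R) :
  dot (scale_tuple a u) v = a * dot u v.
Proof. by rewrite /dot mulr_sumr; apply: eq_bigr => i _; rewrite tnth_mktuple mulrA. Qed.

Lemma dotC (R : realType) p (u v : p.-tuple R) : dot u v = dot v u.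
Proof. by apply: eq_bigr => i _; rewrite mulrC. Qed.

Lemma transports_id (R : realType) d (T : measurableType d)
    (mu : {measure set T -> \bar R}) :
  transports mu mu id (cst (1 : R)).
Proof. by split => // g mg g0; apply: eq_integral => y _; rewrite mule1. Qed.

(** Used for the reflection of Z about its mean and for the reflection of U about
    the origin. *)
Lemma integral_symmetrize (R : realType) d (T : measurableType d)
    (mu : {measure set T -> \bar R}) (phi : T -> T) (F : T -> R) :
  transports mu mu phi (cst (1 : R)) -> measurable_fun setT F ->
  (forall x, 0 <= F x) ->
  (\int[mu]_x (F x)%:E = \int[mu]_x ((F x + F (phi x)) / 2)%:E)%E.
Proof.
move=> [mphi _ _ H] mF F0.
have mEF : measurable_fun setT (EFin \o F) by exact/measurable_EFinP.
have E : (\int[mu]_x (F (phi x))%:E = \int[mu]_x (F x)%:E)%E.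
  rewrite (H (EFin \o F))//; by apply: eq_integral => y _; rewrite mule1.
under [RHS]eq_integral do rewrite EFinM EFinD.
have mEFp : measurable_fun setT (fun x => (F (phi x))%:E).
  exact: (measurableT_comp mEF mphi).
rewrite ge0_integralZr//; last 2 first.
- exact: emeasurable_funD.
- by move=> x _; rewrite adde_ge0// lee_fin.
rewrite ge0_integralD//; [|by move=> x _; rewrite lee_fin..].
rewrite E -[X in (X + X)%E]mul1e -ge0_muleDl// muleAC -EFinD -EFinM.
by rewrite (_ : (1 + 1) * 2^-1 = 1)%R ?mul1e//; field.
Qed.

(** A point of Y is (u, x), a value of U together with one of X = S / sigma^2. *)
Section central_model.
Context (R : realType) (p m : nat) (v : R) (v0 : 0 < v) (xi : p.-tuple R).
Variable Q : probability R R.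
Hypothesis QE : forall A, measurable A -> Q A = chi2_prob m A.

Local Notation Y := (p.-tuple R * R)%type.

Definition gauss (mu : p.-tuple R) (s : R) : probability (p.-tuple R) R :=
  prod_law (fun i => normal_law (tnth mu i) s).

(** The law of (U, X) when xi = 0. *)
Definition central : probability Y R := (prod_law (fun=> normal_law 0 v) \x Q)%E.

(** (S + |U|^2) / sigma^2, whose law under [central] is chi-square. *)
Definition tot (y : Y) : R := y.2 + dot y.1 y.1 / v.
(** The logarithm, up to a constant, of the likelihood ratio between the mean xi
    and the mean 0. *)
Definition tilt (y : Y) : R := dot y.1 xi / v.
Definition dilate (r : R) (y : Y) : Y := (scale_tuple r y.1, r ^+ 2 * y.2).
Definition flip (y : Y) : Y := (scale_tuple (-1) y.1, y.2).

Lemma measurable_tot : measurable_fun setT tot.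
Proof.
apply: measurable_funD => //; apply: measurable_funM => //.
exact: measurable_dot.
Qed.

Lemma measurable_tilt : measurable_fun setT tilt.
Proof. by apply: measurable_funM => //; exact: measurable_dot. Qed.

Lemma measurable_dilate : measurable_fun setT (fun z : Y * R => dilate z.2 z.1).
Proof.
apply: measurable_fun_pair.
  apply/measurable_fun_tnthP => i.
  rewrite (_ : _ \o _ = fun z : Y * R => z.2 * tnth z.1.1 i); last first.
    by apply/funext => z /=; rewrite tnth_mktuple.
  apply: measurable_funM => //.
  apply: (measurableT_comp (measurable_tnth i)).
  exact: (@measurableT_comp _ _ _ _ _ _ fst _ fst).
apply: measurable_funM; first exact: measurable_funX.
exact: (@measurableT_comp _ _ _ _ _ _ snd _ fst).
Qed.

Lemma tot_dilate r y : tot (dilate r y) = r ^+ 2 * tot y.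
Proof. by rewrite /tot /dilate/= dot_scalel dotC dot_scalel; ring. Qed.

Lemma tilt_dilate r y : tilt (dilate r y) = r * tilt y.
Proof. by rewrite /tilt /dilate/= dot_scalel mulrA. Qed.

Lemma transports_dilate r : 0 < r ->
  transports central central (dilate r)
    (fun y => r ^- (p + m) * expR (- ((r ^- 2 - 1) / 2 * tot y))).
Proof.
move=> r0.
have H := transports_prod
  (transports_prod_law (fun _ : 'I_p => normal_transports_scale v0 r0))
  (chi2_transports_scale QE r0).
rewrite (_ : (fun y => _) = (fun y : Y =>
  \prod_(i < p) (r^-1 * expR (- ((r ^- 2 - 1) / 2 * (tnth y.1 i ^+ 2 / v)))) *
   (r ^- m * expR (- ((r ^- 2 - 1) / 2 * y.2)))))//.
apply/funext => y; rewrite big_split/= prodr_const card_ord -expR_sum.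
rewrite mulrACA -expRD -exprVn exprD !exprVn; congr (_ * expR _).
rewrite sumrN -mulr_sumr /tot /dot mulr_suml mulrDr opprD addrC.
by congr (- _ - _); congr (_ * _); apply: eq_bigr => i _; rewrite expr2.
Qed.

Lemma transports_flip : transports central central flip (cst 1).
Proof.
have H := transports_prod
  (transports_prod_law (fun _ : 'I_p => normal_transports_reflect 0 v0))
  (transports_id Q).
rewrite (_ : cst 1 = fun y : Y => \prod_(i < p) 1 * 1); last first.
  by apply/funext => y; rewrite big1 ?mulr1.
rewrite (_ : flip = fun y : Y => ([tuple 2 * 0 - tnth y.1 i | i < p], y.2))//.
apply/funext => y; congr (_, _); apply: eq_from_tnth => i.
by rewrite !tnth_mktuple; ring.
Qed.

Lemma tilt_flip y : tilt (flip y) = - tilt y.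
Proof. by rewrite /tilt /flip/= dot_scalel; ring. Qed.

Lemma tot_flip y : tot (flip y) = tot y.
Proof. by rewrite /tot /flip/= dot_scalel dotC dot_scalel; ring. Qed.

(** Expanding the square in the normal density,
    |u - xi|^2 = |u|^2 - 2 u.xi + |xi|^2. *)
Lemma integral_noncentral (g : Y -> R) : measurable_fun setT g ->
  (forall y, 0 <= g y) ->
  (\int[gauss xi v \x Q]_y (g y)%:E =
   (expR (- (dot xi xi / (v * 2))))%:E *
     \int[central]_y (g y * expR (tilt y))%:E)%E.
Proof.
move=> mg g0.
have [_ _ _ H] := transports_prod
  (transports_prod_law (fun i : 'I_p => normal_transports_center (tnth xi i) v0))
  (transports_id Q).
transitivity (\int[gauss xi v \x Q]_y
    (EFin \o g) ([tuple tnth y.1 i | i < p], y.2))%E.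
  apply: eq_integral => -[u x] _ /=; congr (g (_, _))%:E.
  by apply: eq_from_tnth => i; rewrite tnth_mktuple.
have mEg : measurable_fun setT (EFin \o g) by exact/measurable_EFinP.
apply: (eq_trans (H (EFin \o g) mEg g0)).
rewrite -ge0_integralZl//=; last 2 first.
- apply/measurable_EFinP/measurable_funM => //.
  by apply: measurableT_comp => //; exact: measurable_tilt.
- by move=> y _; rewrite lee_fin mulr_ge0 ?expR_ge0.
apply: eq_integral => y _; rewrite mulr1 -expR_sum -!EFinM; congr EFin.
rewrite mulrCA; congr (_ * _); rewrite -expRD; congr expR.
rewrite sumrB /tilt /dot !mulr_suml addrC.
by congr (- _ + _).
Qed.

End central_model.

(** * The inequality for the conditional means *)

Lemma integral_prob1 (R : realType) d (T : measurableType d) (P : probability T R) :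
  (\int[P]_x (1%R)%:E = 1)%E.
Proof. by rewrite integral_cst//= mul1e probability_setT. Qed.

(** The number k.+1 = p + m - 2 is the q of the introduction: it is at least 1,
    since p >= 1 and m >= 2. *)
Section shrinkage.
Context (R : realType) (p m k : nat) (v : R) (v0 : 0 < v) (xi : p.-tuple R).
Variable Q : probability R R.
Hypothesis QE : forall A, measurable A -> Q A = chi2_prob m A.
Hypothesis pmk : (p + m = k.+3)%N.

Local Notation Y := (p.-tuple R * R)%type.
Local Notation tot := (tot v).
Local Notation tilt := (tilt v xi).
Local Notation M := (central p v Q).

(** The statistic V as a function of (u, x). *)
Definition ratio (y : Y) : R := dot y.1 y.1 / v / tot y.
(** The mean of U.Z / |U|^2 given U, divided by beta. *)
Definition slope (y : Y) : R := dot y.1 xi / dot y.1 y.1.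

Lemma measurable_ratio : measurable_fun setT ratio.
Proof.
apply: measurable_funM; first by apply: measurable_funM => //; exact: measurable_dot.
apply: (measurableT_comp (@measurable_invr R)); exact: measurable_tot.
Qed.

Lemma measurable_slope : measurable_fun setT slope.
Proof.
apply: measurable_funM; first exact: measurable_dot.
by apply: (measurableT_comp (@measurable_invr R)); exact: measurable_dot.
Qed.

Lemma ratio_gt0 y : 0 < ratio y -> 0 < tot y.
Proof.
have : 0 <= dot y.1 y.1 / v by rewrite divr_ge0 ?dot_ge0 ?ltW.
rewrite /ratio le_eqVlt => /predU1P[<-|h]; first by rewrite mul0r ltxx.
by rewrite pmulr_rgt0// invr_gt0.
Qed.

Lemma ratio_tot y : 0 < ratio y -> dot y.1 y.1 = v * (ratio y * tot y).
Proof.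
move=> /ratio_gt0 T0; rewrite /ratio; field.
by rewrite !gt_eqF.
Qed.

Lemma slopeE y : 0 < ratio y -> slope y = tilt y / (ratio y * tot y).
Proof.
move=> V0; have T0 := ratio_gt0 V0.
rewrite /slope (ratio_tot V0) /tilt; field.
by rewrite !gt_eqF.
Qed.

Lemma ratio_dilate r y : 0 < r -> ratio (dilate r y) = ratio y.
Proof.
move=> r0; rewrite /ratio tot_dilate /dilate/= dot_scalel dotC dot_scalel.
rewrite invfM; move: (tot y)^-1 => t; field.
by rewrite !gt_eqF.
Qed.

Lemma ratio_flip y : ratio (flip y) = ratio y.
Proof. by rewrite /ratio tot_flip /flip/= dot_scalel dotC dot_scalel !mulN1r opprK. Qed.

Lemma slope_flip y : slope (flip y) = - slope y.
Proof.
rewrite /slope /flip/= !dot_scalel [dot y.1 (scale_tuple _ _)]dotC dot_scalel.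
by rewrite !mulN1r opprK mulNr.
Qed.

(** The average of (f(V) w0 - 1)^2 e^w over the reflection u |-> -u, by
    [sym_lossE]. *)
Definition sym_loss (f : R -> R) (y : Y) : R :=
  (f (ratio y) ^+ 2 * slope y ^+ 2 + 1) * cosh (tilt y) -
  2 * f (ratio y) * slope y * sinh (tilt y).

Lemma sym_lossE f y : sym_loss f y =
  ((f (ratio y) * slope y - 1) ^+ 2 * expR (tilt y) +
   (f (ratio (flip y)) * slope (flip y) - 1) ^+ 2 * expR (tilt (flip y))) / 2.
Proof.
rewrite ratio_flip slope_flip tilt_flip /sym_loss /cosh /sinh; field => //.
Qed.

(* Functions vanishing outside ]0, 1[: the integrals see no other values, and
   the conditions on psi and psibar then hold at every real t. *)
Variables (psi psibar : R -> R).
Hypothesis mpsi : measurable_fun setT psi.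
Hypothesis mpsibar : measurable_fun setT psibar.
Hypothesis psi0 : forall t : R, ~~ (0 < t < 1) -> psi t = 0.
Hypothesis psibar0 : forall t : R, ~~ (0 < t < 1) -> psibar t = 0.
Hypothesis hsq : forall t, psi t ^+ 2 <= psibar t ^+ 2.
Hypothesis hDelta : forall t, Delta p m psi psibar t <= 0.

Lemma sym_loss_ge0 f y : 0 <= sym_loss f y.
Proof. by rewrite sym_lossE divr_ge0// addr_ge0// mulr_ge0 ?expR_ge0 ?sqr_ge0. Qed.

Lemma measurable_sinh : measurable_fun setT (@sinh R).
Proof.
by apply: continuous_measurable_fun; apply: derivable1_continuous => x.
Qed.

Lemma measurable_cosh : measurable_fun setT (@cosh R).
Proof.
by apply: continuous_measurable_fun; apply: derivable1_continuous => x.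
Qed.

Lemma measurable_sym_loss f : measurable_fun setT f -> measurable_fun setT (sym_loss f).
Proof.
move=> mf.
have mfr := measurableT_comp mf measurable_ratio.
have mc := measurableT_comp measurable_cosh (measurable_tilt v xi).
have ms := measurableT_comp measurable_sinh (measurable_tilt v xi).
have msl := measurable_slope.
apply: measurable_funB; apply: measurable_funM => //.
  by apply: measurable_funD => //; apply: measurable_funM; exact: measurable_funX.
by apply: measurable_funM => //; exact: measurable_funM.
Qed.

(** The functions K, A and B of the introduction. *)
Definition gap (y : Y) : R :=
  (psibar (ratio y) ^+ 2 - psi (ratio y) ^+ 2) / ratio y ^+ 2.
Definition cross_gap (y : Y) : R := gap y * (tilt y * sinh (tilt y)) / tot y / k.+1%:R.
Definition square_gap (y : Y) : R := gap y * (tilt y ^+ 2 * cosh (tilt y)) / tot y ^+ 2.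

Lemma gap_ge0 y : 0 <= gap y.
Proof. by rewrite divr_ge0 ?sqr_ge0// subr_ge0. Qed.

Lemma gap_eq0 y : ~~ (0 < ratio y < 1) -> gap y = 0.
Proof. by move=> h; rewrite /gap psi0// psibar0// subrr mul0r. Qed.

Lemma measurable_gap : measurable_fun setT gap.
Proof.
have mr := measurable_ratio.
apply: measurable_funM.
  by apply: measurable_funB; apply: measurable_funX; exact: measurableT_comp.
by apply: (measurableT_comp (@measurable_invr R)); exact: measurable_funX.
Qed.

Lemma measurable_cross_gap : measurable_fun setT cross_gap.
Proof.
have mt := @measurable_tot R p v; have ml := measurable_tilt v xi.
apply: measurable_funM => //; apply: measurable_funM.
  apply: measurable_funM; first exact: measurable_gap.
  by apply: measurable_funM => //; exact: (measurableT_comp measurable_sinh).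
exact: (measurableT_comp (@measurable_invr R)).
Qed.

Lemma measurable_square_gap : measurable_fun setT square_gap.
Proof.
have mt := @measurable_tot R p v; have ml := measurable_tilt v xi.
apply: measurable_funM.
  apply: measurable_funM; first exact: measurable_gap.
  apply: measurable_funM; first exact: measurable_funX.
  exact: (measurableT_comp measurable_cosh).
apply: (measurableT_comp (@measurable_invr R)); exact: measurable_funX.
Qed.

Lemma cross_gap_ge0 y : 0 <= cross_gap y.
Proof.
have [h|h] := boolP (0 < ratio y < 1); last by rewrite /cross_gap gap_eq0// !mul0r.
have T0 : 0 < tot y by apply: ratio_gt0; case/andP: h.
rewrite mulr_ge0 ?invr_ge0// mulr_ge0 ?invr_ge0 ?(ltW T0)//.
by rewrite mulr_ge0 ?gap_ge0 ?mul_sinh_ge0.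
Qed.

Lemma square_gap_ge0 y : 0 <= square_gap y.
Proof.
by rewrite divr_ge0 ?sqr_ge0// mulr_ge0 ?gap_ge0// mulr_ge0 ?sqr_ge0 ?cosh_ge0.
Qed.

(** [gap] is constant along rays, so on each ray this is the hyperbolic
    inequality. *)
Lemma le_integral_gap : (\int[M]_y (cross_gap y)%:E <= \int[M]_y (square_gap y)%:E)%E.
Proof.
have T0 y : tot y <= 0 -> gap y = 0.
  move=> T0; apply: gap_eq0; apply/negP => /andP[/ratio_gt0]; lra.
apply: (@le_integral_radial _ _ _ _ tot (@dilate R p) k.+2).
- exact: measurable_tot.
- exact: measurable_dilate.
- by move=> r y; exact: tot_dilate.
- by move=> r r0; rewrite -pmk; exact: transports_dilate.
- exact: measurable_cross_gap.
- exact: measurable_square_gap.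
- exact: cross_gap_ge0.
- exact: square_gap_ge0.
- by move=> y /T0 h; rewrite /cross_gap h !mul0r.
- by move=> y /T0 h; rewrite /square_gap h !mul0r.
move=> y y0; rewrite /ray.
have gd r : 0 < r -> gap (dilate r y) = gap y.
  by move=> r0; rewrite /gap ratio_dilate.
(* Along the ray through y, with tilt r (tilt y) and total r^2 (tot y), both
   integrands are c times those of the hyperbolic inequality. *)
pose c := gap y / tot y ^+ 2 / k.+1%:R.
have c0 : 0 <= c.
  by rewrite mulr_ge0 ?invr_ge0// mulr_ge0 ?gap_ge0// invr_ge0 sqr_ge0.
have := radial_sinh_le_cosh (tilt y) k y0 c0.
rewrite (_ : (fun r => _) = fun r => (if 0 < r then cross_gap (dilate r y) *
  r ^+ k.+2 * expR (- (tot y * r ^+ 2 / 2)) else 0)%:E); last first.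
  apply/funext => r; case: ifPn => // r0; congr EFin.
  rewrite /cross_gap gd// tot_dilate tilt_dilate /c !exprS.
  rewrite [r * tilt y]mulrC; move: (expR _) (sinh _) => e s; field.
  by rewrite !gt_eqF.
congr (_ <= _)%E; apply: eq_integral => r _; case: ifPn => // r0; congr EFin.
rewrite /square_gap gd// tot_dilate tilt_dilate /c !exprS.
rewrite [r * tilt y]mulrC; move: (expR _) (cosh _) => e s; field.
by rewrite !gt_eqF.
Qed.

(** The difference of the two sides is -Delta times w sinh w over a positive
    number. *)
Lemma sym_loss_gap y : sym_loss psi y + square_gap y <= sym_loss psibar y + cross_gap y.
Proof.
have [h|h] := boolP (0 < ratio y < 1); last first.
  by rewrite /cross_gap /square_gap gap_eq0// !mul0r !addr0 /sym_loss psi0// psibar0.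
have /andP[V0 _] := h; have T0 := ratio_gt0 V0.
have qE : p%:R + m%:R - 2 = k.+1%:R :> R.
  by rewrite -natrD pmk -[k.+3]addn2 natrD addrK.
have D := hDelta (ratio y); rewrite /Delta qE in D.
set a := psi (ratio y) in D *; set b := psibar (ratio y) in D *.
set V := ratio y in V0 D *; set t := tot y in T0 *.
have wsh := mul_sinh_ge0 (tilt y).
have E : sym_loss psibar y + cross_gap y - (sym_loss psi y + square_gap y) =
    (tilt y * sinh (tilt y)) / (V ^+ 2 * t * k.+1%:R) *
    - (a ^+ 2 - b ^+ 2 - 2 * k.+1%:R * V * (a - b)).
  rewrite /sym_loss /cross_gap /square_gap /gap slopeE// -/V -/t -/a -/b.
  move: (tilt y) (sinh _) (cosh _) => w s c; field.
  by rewrite !gt_eqF.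
rewrite -subr_ge0 E mulr_ge0 ?oppr_ge0// divr_ge0//.
by rewrite mulr_ge0 ?ler0n// mulr_ge0 ?sqr_ge0// ltW.
Qed.

Lemma integral_sym_loss (f : R -> R) : measurable_fun setT f ->
  (\int[gauss xi v \x Q]_y ((f (ratio y) * slope y - 1) ^+ 2)%:E =
   (expR (- (dot xi xi / (v * 2))))%:E * \int[M]_y (sym_loss f y)%:E)%E.
Proof.
move=> mf.
have mg : measurable_fun setT (fun y : Y => (f (ratio y) * slope y - 1) ^+ 2).
  apply: measurable_funX; apply: measurable_funB => //.
  apply: measurable_funM; last exact: measurable_slope.
  exact: (measurableT_comp mf measurable_ratio).
apply: (eq_trans (integral_noncentral v0 xi Q mg (fun y => sqr_ge0 _))).
congr (_ * _)%E.
apply: (eq_trans (integral_symmetrize (transports_flip p v0 Q) _ _)).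
- apply: measurable_funM => //; apply: measurableT_comp => //.
  exact: measurable_tilt.
- by move=> y; rewrite mulr_ge0 ?sqr_ge0 ?expR_ge0.
- by apply: eq_integral => y _; rewrite sym_lossE.
Qed.

(** From psibar^2 - psi^2 <= psibar^2 and, with y = psibar w0,
    y^2 <= 2 (y - 1)^2 + 2 and y^2 <= 2 (y + 1)^2 + 2. *)
Lemma square_gap_le y : square_gap y <= 2 * sym_loss psibar y + 2 * cosh (tilt y).
Proof.
have [h|h] := boolP (0 < ratio y < 1); last first.
  rewrite /square_gap gap_eq0// !mul0r addr_ge0// mulr_ge0// ?sym_loss_ge0//.
  exact: cosh_ge0.
have /andP[V0 _] := h; have T0 := ratio_gt0 V0.
apply: (@le_trans _ _ (psibar (ratio y) ^+ 2 * slope y ^+ 2 * cosh (tilt y))).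
  have -> : square_gap y = (psibar (ratio y) ^+ 2 - psi (ratio y) ^+ 2) * slope y ^+ 2
      * cosh (tilt y).
    rewrite /square_gap /gap slopeE//; move: (cosh _) => c; field.
    by rewrite !gt_eqF.
  rewrite ler_wpM2r ?cosh_ge0// ler_wpM2r ?sqr_ge0// gerBl sqr_ge0//.
rewrite sym_lossE ratio_flip slope_flip tilt_flip /cosh.
set x := psibar _; set w := slope y.
have := expR_ge0 (tilt y); have := expR_ge0 (- tilt y).
move: (expR _) (expR _) => e1 e2 e10 e20.
rewrite -subr_ge0.
rewrite [X in 0 <= X](_ : _ = ((x * w - 2) ^+ 2 * e1 + (x * w + 2) ^+ 2 * e2) / 2).
  by rewrite divr_ge0// addr_ge0// mulr_ge0// sqr_ge0.
by field.
Qed.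

(** Up to a positive factor this integral is the total mass of the law of
    (U, X). *)
Lemma integral_cosh_lty : (\int[M]_y (cosh (tilt y))%:E < +oo)%E.
Proof.
have sym : (\int[M]_y (expR (tilt y))%:E = \int[M]_y (cosh (tilt y))%:E)%E.
  apply: (eq_trans (integral_symmetrize (transports_flip p v0 Q) _ _)).
  - by apply: measurableT_comp => //; exact: measurable_tilt.
  - by move=> y; exact: expR_ge0.
  - by apply: eq_integral => y _; rewrite tilt_flip.
have E : (1 = (expR (- (dot xi xi / (v * 2))))%:E *
    \int[M]_y (cosh (tilt y))%:E)%E.
  rewrite -sym -(integral_prob1 (gauss xi v \x Q)%E).
  apply: (eq_trans (@integral_noncentral R p v v0 xi Q (fun=> 1)
    (measurable_cst _) (fun _ => ler01))).
  by congr (_ * _)%E; apply: eq_integral => y _; rewrite mul1r.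
have : (0 <= \int[M]_y (cosh (tilt y))%:E)%E.
  by apply: integral_ge0 => y _; rewrite lee_fin cosh_ge0.
move: E; case: (\int[M]_y _)%E => [r|E _|//]; first by rewrite ltry.
by move: E; rewrite gt0_muley// lte_fin expR_gt0.
Qed.

(** Integrate [sym_loss_gap], bound the integral of [cross_gap] by that of
    [square_gap], and cancel the latter, which is finite unless the right-hand
    side is infinite. *)
Lemma le_integral_sym_loss :
  (\int[M]_y (sym_loss psi y)%:E <= \int[M]_y (sym_loss psibar y)%:E)%E.
Proof.
have mE (f : R -> R) : measurable_fun setT f -> measurable_fun setT (EFin \o sym_loss f).
  by move=> mf; apply/measurable_EFinP; exact: measurable_sym_loss.
have mA : measurable_fun setT (EFin \o cross_gap).
  by apply/measurable_EFinP; exact: measurable_cross_gap.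
have mB : measurable_fun setT (EFin \o square_gap).
  by apply/measurable_EFinP; exact: measurable_square_gap.
have mc : measurable_fun setT (fun y : Y => (cosh (tilt y))%:E).
  by apply/measurable_EFinP; exact: (measurableT_comp measurable_cosh (measurable_tilt v xi)).
have [fin|] := ltP (\int[M]_y (sym_loss psibar y)%:E)%E +oo%E; last first.
  by rewrite leye_eq => /eqP ->; rewrite leey.
have finB : (\int[M]_y (square_gap y)%:E < +oo)%E.
  apply: (@le_lt_trans _ _ (\int[M]_y
      ((2%:E * (sym_loss psibar y)%:E) + 2%:E * (cosh (tilt y))%:E))%E).
    apply: ge0_le_integral => //.
    - by move=> y _; rewrite lee_fin square_gap_ge0.
    - apply: emeasurable_funD; apply: emeasurable_funM => //; exact: mE.
    - by move=> y _; rewrite -!EFinM -EFinD lee_fin square_gap_le.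
  rewrite ge0_integralD//; last 4 first.
  - by move=> y _; rewrite mule_ge0 ?lee_fin ?sym_loss_ge0.
  - by apply: emeasurable_funM => //; exact: mE.
  - by move=> y _; rewrite mule_ge0 ?lee_fin ?cosh_ge0.
  - by apply: emeasurable_funM.
  have Z (f : Y -> R) : measurable_fun setT (EFin \o f) -> (forall y, 0 <= f y) ->
      (\int[M]_y (f y)%:E < +oo)%E -> (\int[M]_y (2%:E * (f y)%:E) < +oo)%E.
    move=> mf f0 h; rewrite ge0_integralZl//; last by move=> y _; rewrite lee_fin.
    exact: lte_mul_pinfty.
  apply: lte_add_pinfty; apply: Z => //.
  - exact: mE.
  - by move=> y; exact: sym_loss_ge0.
  - by move=> y; exact: cosh_ge0.
  - exact: integral_cosh_lty.
have B0 : (0 <= \int[M]_y (square_gap y)%:E)%E.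
  by apply: integral_ge0 => y _; rewrite lee_fin square_gap_ge0.
rewrite -(@leeD2rE _ (\int[M]_y (square_gap y)%:E)%E) ?ge0_fin_numE//.
apply: (@le_trans _ _ (\int[M]_y (sym_loss psibar y)%:E + \int[M]_y (cross_gap y)%:E)%E); last first.
  by apply: leeD => //; exact: le_integral_gap.
rewrite -!ge0_integralD//; try by [exact: mE|
  move=> y _; rewrite lee_fin ?sym_loss_ge0 ?cross_gap_ge0 ?square_gap_ge0].
apply: ge0_le_integral => //.
- by move=> y _; rewrite adde_ge0// lee_fin ?sym_loss_ge0 ?square_gap_ge0.
- by apply: emeasurable_funD => //; exact: mE.
- by apply: emeasurable_funD => //; exact: mE.
- by move=> y _; rewrite -!EFinD lee_fin sym_loss_gap.
Qed.

Lemma le_integral_slope :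
  (\int[gauss xi v \x Q]_y ((psi (ratio y) * slope y - 1) ^+ 2)%:E <=
   \int[gauss xi v \x Q]_y ((psibar (ratio y) * slope y - 1) ^+ 2)%:E)%E.
Proof.
(* The two sides have the same norming factor c. *)
have scaled (c a a' b b' : \bar R) : (0 <= c -> a = c * a' -> b = c * b' -> a' <= b' ->
    a <= b)%E by move=> c0 -> ->; exact: lee_wpmul2l.
apply: (scaled _ _ _ _ _ _ (integral_sym_loss mpsi) (integral_sym_loss mpsibar)).
  by rewrite lee_fin expR_ge0.
exact: le_integral_sym_loss.
Qed.

End shrinkage.

(** * Removing the noise of Z *)

(** PY stands for the law of (U, X); the argument rests on the symmetry of Z about
    its mean beta xi. *)
Section noise_removal.
Context (R : realType) (p : nat) (v tau2 beta : R) (t0 : 0 < tau2).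
Variables (xi : p.-tuple R).

Local Notation Y := (p.-tuple R * R)%type.
Local Notation PZ := (gauss (scale_tuple beta xi) tau2).
Variable PY : probability (p.-tuple R * R)%type R.

Definition loss (f : R -> R) (w : p.-tuple R * Y) : R :=
  (f (ratio v w.2) * (dot w.2.1 w.1 / dot w.2.1 w.2.1) - beta) ^+ 2.

Definition mirror (w : p.-tuple R * Y) : p.-tuple R * Y :=
  ([tuple 2 * tnth (scale_tuple beta xi) i - tnth w.1 i | i < p], w.2).

Lemma transports_mirror : transports (PZ \x PY)%E (PZ \x PY)%E mirror (cst (1 : R)).
Proof.
have H := transports_prod
  (transports_prod_law (fun i : 'I_p =>
    normal_transports_reflect (tnth (scale_tuple beta xi) i) t0))
  (transports_id PY).
rewrite (_ : cst 1 = fun y : p.-tuple R * Y => \prod_(i < p) 1 * 1)//.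
by apply/funext => y; rewrite big1 ?mulr1.
Qed.

Lemma dot_mirror u z : dot u [tuple 2 * tnth (scale_tuple beta xi) i - tnth z i | i < p] =
  2 * (beta * dot u xi) - dot u z.
Proof.
rewrite /dot !mulr_sumr -sumrB; apply: eq_bigr => i _.
by rewrite !tnth_mktuple; ring.
Qed.

(** The part of the squared error due to the deviation of U.Z / |U|^2 from its
    mean given U. *)
Definition noise (f : R -> R) (w : p.-tuple R * Y) : R :=
  f (ratio v w.2) ^+ 2 *
  (dot w.2.1 w.1 / dot w.2.1 w.2.1 - beta * slope xi w.2) ^+ 2.

(** With d = b - beta w0, reflecting Z changes the sign of d in
    (psi beta w0 - beta) + psi d, so the cross term averages out. *)
Lemma loss_mirror f w : (loss f w + loss f (mirror w)) / 2 =
  noise f w + beta ^+ 2 * (f (ratio v w.2) * slope xi w.2 - 1) ^+ 2.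
Proof.
rewrite /loss /noise /mirror/= dot_mirror /slope; move: (_^-1) => D.
by field.
Qed.

Lemma measurable_loss f : measurable_fun setT f -> measurable_fun setT (loss f).
Proof.
move=> mf; apply: measurable_funX; apply: measurable_funB => //.
have m21 : measurable_fun setT (fun w : p.-tuple R * Y => w.2.1).
  exact: (@measurableT_comp _ _ _ _ _ _ fst _ snd).
apply: measurable_funM.
  apply: (measurableT_comp mf).
  exact: (@measurableT_comp _ _ _ _ _ _ _ _ snd (@measurable_ratio R p v)).
apply: measurable_funM; first exact: measurable_dot.
by apply: (measurableT_comp (@measurable_invr R)); exact: measurable_dot.
Qed.

Lemma measurable_noise f : measurable_fun setT f -> measurable_fun setT (noise f).
Proof.
move=> mf.
have m21 : measurable_fun setT (fun w : p.-tuple R * Y => w.2.1).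
  exact: (@measurableT_comp _ _ _ _ _ _ fst _ snd).
apply: measurable_funM; apply: measurable_funX.
  apply: (measurableT_comp mf).
  exact: (@measurableT_comp _ _ _ _ _ _ _ _ snd (@measurable_ratio R p v)).
apply: measurable_funB; last first.
  apply: measurable_funM => //.
  exact: (@measurableT_comp _ _ _ _ _ _ _ _ snd (@measurable_slope R p xi)).
apply: measurable_funM; first exact: measurable_dot.
by apply: (measurableT_comp (@measurable_invr R)); exact: measurable_dot.
Qed.

Lemma integral_loss (f : R -> R) : measurable_fun setT f ->
  (\int[PZ \x PY]_w (loss f w)%:E =
   \int[PZ \x PY]_w (noise f w)%:E + (beta ^+ 2)%:E *
     \int[PY]_y ((f (ratio v y) * slope xi y - 1) ^+ 2)%:E)%E.
Proof.
move=> mf; rewrite (integral_symmetrize transports_mirror); last 2 first.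
- exact: measurable_loss.
- by move=> w; rewrite sqr_ge0.
pose e (y : Y) := (f (ratio v y) * slope xi y - 1) ^+ 2.
have me : measurable_fun setT e.
  apply: measurable_funX; apply: measurable_funB => //.
  apply: measurable_funM; last exact: measurable_slope.
  exact: (measurableT_comp mf (@measurable_ratio R p v)).
have me2 : measurable_fun setT (fun w : p.-tuple R * Y => (beta ^+ 2 * e w.2)%:E).
  by apply/measurable_EFinP/measurable_funM => //; exact: (measurableT_comp me).
have e0 y : (0 <= (beta ^+ 2 * e y)%:E)%E by rewrite lee_fin mulr_ge0 ?sqr_ge0.
have mn : measurable_fun setT (fun w => (noise f w)%:E).
  by apply/measurable_EFinP; exact: measurable_noise.
have n0 w : (0 <= (noise f w)%:E)%E by rewrite lee_fin mulr_ge0 ?sqr_ge0.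
under eq_integral do rewrite loss_mirror EFinD.
rewrite (ge0_integralD _ measurableT (fun w _ => n0 w) mn (fun w _ => e0 w.2) me2).
congr (_ + _)%E.
have /= -> := @fubini_tonelli2 _ _ _ _ R PZ PY
  (fun w : p.-tuple R * Y => (beta ^+ 2 * e w.2)%:E) me2 (fun w => e0 w.2).
have mEe : measurable_fun setT (EFin \o e) by apply/measurable_EFinP.
have ee0 y : (0 <= (EFin \o e) y)%E by rewrite lee_fin sqr_ge0.
have b0 : (0 <= (beta ^+ 2)%:E)%E by rewrite lee_fin sqr_ge0.
rewrite -(ge0_integralZl _ measurableT mEe (fun y _ => ee0 y) b0).
apply: eq_integral => y _; rewrite /fubini_G/=.
by rewrite integral_cst//= probability_setT mule1 EFinM.
Qed.

Lemma le_integral_loss (psi psibar : R -> R) :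
  measurable_fun setT psi -> measurable_fun setT psibar ->
  (forall t, psi t ^+ 2 <= psibar t ^+ 2) ->
  (\int[PY]_y ((psi (ratio v y) * slope xi y - 1) ^+ 2)%:E <=
   \int[PY]_y ((psibar (ratio v y) * slope xi y - 1) ^+ 2)%:E)%E ->
  (\int[PZ \x PY]_w (loss psi w)%:E <= \int[PZ \x PY]_w (loss psibar w)%:E)%E.
Proof.
move=> mpsi mpsibar hsq H; rewrite !integral_loss//; apply: leeD.
  apply: ge0_le_integral => //.
  - by move=> w _; rewrite lee_fin mulr_ge0 ?sqr_ge0.
  - apply/measurable_EFinP; exact: measurable_noise.
  - apply/measurable_EFinP; exact: measurable_noise.
  - by move=> w _; rewrite lee_fin ler_wpM2r ?sqr_ge0.
by rewrite lee_wpmul2l ?lee_fin ?sqr_ge0.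
Qed.

End noise_removal.

(** * Joint laws *)

(** The factor c is there for [triple_law], where m is the restriction of P to
    an event and thus has mass c. *)
Lemma pair_law (R : realType) d d1 d2 (T : measurableType d)
    (T1 : measurableType d1) (T2 : measurableType d2) (m : {measure set T -> \bar R})
    (f1 : T -> T1) (f2 : T -> T2) (Q1 : probability T1 R) (Q2 : probability T2 R)
    (c : R) :
  measurable_fun setT f1 -> measurable_fun setT f2 -> 0 <= c ->
  (forall A B, measurable A -> measurable B ->
    m (f1 @^-1` A `&` f2 @^-1` B) = (c%:E * (Q1 A * Q2 B))%E) ->
  forall D, measurable D ->
    m ((fun w => (f1 w, f2 w)) @^-1` D) = (c%:E * (Q1 \x Q2) D)%E.
Proof.
move=> mf1 mf2 c0 H D mD.
have mf : measurable_fun setT (fun w => (f1 w, f2 w)) by exact: measurable_fun_pair.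
pose f : {mfun T >-> (T1 * T2)%type} := HB.pack (fun w => (f1 w, f2 w))
  (isMeasurableFun.Build _ _ _ _ _ mf).
pose G := [set A `*` B | A in (measurable : set (set T1)) & B in (measurable : set (set T2))].
have E A B : measurable A -> measurable B ->
    pushforward m f (A `*` B) = mscale (NngNum c0) (Q1 \x Q2)%E (A `*` B).
  move=> mA mB; rewrite /pushforward /mscale/= product_measure1E//.
  by rewrite -H//; congr (m _); apply/seteqP; split.
apply: (@measure_unique _ R (T1 * T2)%type G (fun=> setT) _ _ _ _
  (pushforward m f) (mscale (NngNum c0) (Q1 \x Q2)%E)) => //.
- exact: measurable_prod_measurableType.
- move=> _ _ [A mA [B mB <-]] [A' mA' [B' mB' <-]].
  rewrite -setXI; exists (A `&` A'); first exact: measurableI.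
  by exists (B `&` B') => //; exact: measurableI.
- by move=> _; exists setT => //; exists setT => //; rewrite setXTT.
- by rewrite bigcup_const//; exists 0.
- by move=> _ [A mA [B mB <-]]; exact: E.
- move=> _; have h := E setT setT measurableT measurableT.
  rewrite setXTT in h; rewrite [X in (X < _)%E]h /mscale/= probability_setT mule1.
  exact: ltry.
Qed.

(** A product formula for triples of events only concerns rectangles; [pair_law]
    extends it first in the last two variables, under the restriction of P to the
    event f1 in A, and then in the first. *)
Lemma triple_law (R : realType) d d1 d2 d3 (T : measurableType d)
    (T1 : measurableType d1) (T2 : measurableType d2) (T3 : measurableType d3)
    (P : probability T R) (f1 : T -> T1) (f2 : T -> T2) (f3 : T -> T3)
    (Q1 : probability T1 R) (Q2 : probability T2 R) (Q3 : probability T3 R) :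
  measurable_fun setT f1 -> measurable_fun setT f2 -> measurable_fun setT f3 ->
  (forall A B C, measurable A -> measurable B -> measurable C ->
    P (f1 @^-1` A `&` f2 @^-1` B `&` f3 @^-1` C) = (Q1 A * Q2 B * Q3 C)%E) ->
  forall D, measurable D ->
    P ((fun w => (f1 w, (f2 w, f3 w))) @^-1` D) = (Q1 \x (Q2 \x Q3))%E D.
Proof.
move=> mf1 mf2 mf3 H D mD; rewrite -[RHS]mul1e.
apply: (@pair_law _ _ _ _ _ _ _ P f1 (fun w => (f2 w, f3 w))) => //.
  exact: measurable_fun_pair.
move=> A E mA mE; rewrite mul1e setIC.
have mF1 : measurable (f1 @^-1` A) by rewrite -[X in measurable X]setTI; exact: mf1.
have QA : Q1 A = (fine (Q1 A))%:E by rewrite fineK// fin_num_measure.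
rewrite [in RHS]QA.
apply: (@pair_law _ _ _ _ _ _ _ (mrestr P mF1) f2 f3) => //.
  by rewrite fine_ge0.
move=> B C mB mC; rewrite -QA muleA -H// /mrestr; congr (P _).
by rewrite setIC setIA.
Qed.

(** * Comparison of the mean squared errors *)

(** The hypothesis only gives the probabilities of boxes, which determine the
    law. *)
Lemma spherical_normalE (R : realType) d (T : measurableType d) (P : probability T R) p
    (X : {RV P >-> p.-tuple R}) (mu : p.-tuple R) (v : R) :
  spherical_normal P X mu v ->
  forall A, measurable A -> P (X @^-1` A) = gauss mu v A.
Proof.
move=> hX A mA.
apply: (@tuple_law_unique R p (distribution P X) (gauss mu v) _ A mA) => {mA} {}A mA.
by rewrite [LHS]hX//; apply/esym; exact: prod_law_box.
Qed.

Lemma integral_of_law (R : realType) d d' (T : measurableType d)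
    (T' : measurableType d') (P : probability T R) (Q : probability T' R)
    (J : T -> T') (g : T' -> R) :
  measurable_fun setT J -> (forall D, measurable D -> P (J @^-1` D) = Q D) ->
  measurable_fun setT g -> (forall y, 0 <= g y) ->
  (\int[P]_w (g (J w))%:E = \int[Q]_y (g y)%:E)%E.
Proof.
move=> mJ law mg g0.
have mEg : measurable_fun setT (EFin \o g) by apply/measurable_EFinP.
have := @ge0_integral_pushforward _ _ _ _ R J mJ P setT (EFin \o g)
  measurableT mEg (fun y _ => g0 y).
rewrite preimage_setT => <-.
by apply: eq_measure_integral => // D mD _; exact: law.
Qed.

Lemma Vstat_ratio (R : realType) p (v x : R) (u : p.-tuple R) : 0 < v -> 0 < x ->
  Vstat u (v * x) = ratio v (u, x).
Proof.
move=> v0 x0; rewrite /Vstat /ratio /tot/= enorm_sqr.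
have D0 := dot_ge0 u; field.
by rewrite !gt_eqF// ltr_wpDr// mulr_gt0.
Qed.

(** Where u = 0, the estimator U.Z / |U|^2 is 0, so that psi is only ever read on
    ]0, 1[. *)
Lemma Vstat_itv (R : realType) p (s : R) (u : p.-tuple R) : 0 < s -> dot u u != 0 ->
  0 < Vstat u s < 1.
Proof.
move=> s0 u0; have D0 : 0 < dot u u by rewrite lt_neqAle eq_sym u0 dot_ge0.
rewrite /Vstat enorm_sqr divr_gt0 ?addr_gt0//= ltr_pdivrMr ?addr_gt0//.
by rewrite mul1r ltrDr.
Qed.

(** The passage from the probability space to the product law of (Z, (U, X)),
    and from f to its restriction to ]0, 1[, extended by 0. *)
Lemma MSE_loss (R : realType) (p : nat) (f : R -> R)
    (mf : measurable_fun (`]0, 1[ : set R) f)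
    (beta sigma2 tau2 : R) (xi : p.-tuple R)
    (hsigma2 : 0 < sigma2)
    (d : measure_display) (T : measurableType d) (P : probability T R)
    (Z U : {RV P >-> p.-tuple R}) (S X : {RV P >-> R})
    (hS : forall w : T, 0 < S w) (hX : forall w, X w = S w / sigma2)
    (hind : independent3 P Z U S)
    (hZ : spherical_normal P Z (scale_tuple beta xi) tau2)
    (hU : spherical_normal P U xi sigma2) :
  (MSE P (beta_hat f Z U S) beta =
   \int[gauss (scale_tuple beta xi) tau2 \x (gauss xi sigma2 \x distribution P X)]_w
     (loss sigma2 beta (f \_ `]0%R, 1%R[) w)%:E)%E.
Proof.
set fr := f \_ _.
have mfr : measurable_fun setT fr.
  exact/(measurable_restrictT f (measurable_itv _)).
pose J w := (Z w, (U w, X w)).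
have mJ : measurable_fun setT J.
  by apply: measurable_fun_pair => //; exact: measurable_fun_pair.
have lawJ D : measurable D -> P (J @^-1` D) =
    (gauss (scale_tuple beta xi) tau2 \x (gauss xi sigma2 \x distribution P X))%E D.
  move: D; apply: triple_law => // A B C mA mB mC.
  pose C' := [set s | C (s / sigma2)].
  have mC' : measurable C'.
    rewrite -[C']setTI; apply: (measurable_funM (@measurable_id _ _ setT)
      (measurable_cst (sigma2^-1))) => //.
  rewrite (_ : X @^-1` C = S @^-1` C'); last first.
    by apply/seteqP; split=> w /=; rewrite hX.
  rewrite hind// (spherical_normalE hZ mA) (spherical_normalE hU mB); congr (_ * _)%E.
  rewrite /distribution /pushforward; congr (P _).
  by apply/seteqP; split=> w /=; rewrite hX.
rewrite /MSE unlock.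
apply: (eq_trans _ (integral_of_law mJ lawJ (measurable_loss sigma2 beta mfr)
  (fun y => sqr_ge0 _))).
apply: eq_integral => w _; rewrite /= /loss/= /beta_hat /betaLS enorm_sqr.
congr ((_ - _) ^+ 2)%:E.
have X0 : 0 < X w by rewrite hX divr_gt0.
have SE : S w = sigma2 * X w by rewrite hX mulrCA divff ?mulr1// gt_eqF.
rewrite -Vstat_ratio// -SE.
have [u0|u0] := eqVneq (dot (U w) (U w)) 0; first by rewrite u0 invr0 !mulr0.
by rewrite /fr patchE mem_set//= in_itv/=; exact: Vstat_itv.
Qed.

Unset Implicit Arguments.

Theorem theorem4p1 (R : realType) (n r p m : nat)
    (hn : (2 <= n)%N) (hr : (2 <= r)%N)
    (hp : p = n.-1) (hm : m = (n * r.-1)%N)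
    (psi psibar : R -> R)
    (mpsi : measurable_fun (`]0, 1[ : set R) psi)
    (mpsibar : measurable_fun (`]0, 1[ : set R) psibar)
    (hsq : forall v : R, 0 < v < 1 -> psi v ^+ 2 <= psibar v ^+ 2)
    (hDelta : forall v : R, 0 < v < 1 -> Delta p m psi psibar v <= 0)
    (beta sigma2 tau2 : R) (xi : p.-tuple R)
    (hxi : xi <> [tuple 0 | _ < p]) (hsigma2 : 0 < sigma2) (htau2 : 0 < tau2)
    (d : measure_display) (T : measurableType d) (P : probability T R)
    (Z U : {RV P >-> p.-tuple R}) (S : {RV P >-> R})
    (hS : forall w : T, 0 < S w)
    (hind : independent3 P Z U S)
    (hZ : spherical_normal P Z (scale_tuple beta xi) tau2)
    (hU : spherical_normal P U xi sigma2)
    (hchi : scaled_chi2 P S sigma2 m)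
    (hmom : ('E_P[fun w => (beta_hat psibar Z U S w ^+ 2)%R] < +oo)%E) :
  (MSE P (beta_hat psi Z U S) beta <= MSE P (beta_hat psibar Z U S) beta)%E.
Proof.
have [k pmk] : exists k, (p + m = k.+3)%N.
  exists (p + m - 3)%N; have : (3 <= p + m)%N.
    rewrite hp hm; clear -hn hr.
    case: n hn => [|[|n]]//= _; case: r hr => [|[|r]]//= _.
    by rewrite mulnS addnA; apply: leq_trans (leq_addr _ _); exact: (@leq_add 1 2).
  by move=> h; rewrite -addn3 subnK.
have mX : measurable_fun setT (fun w => S w / sigma2) by exact: measurable_funM.
pose X : {RV P >-> R} := HB.pack (fun w => S w / sigma2)
  (isMeasurableFun.Build _ _ _ _ _ mX).
have XE w : X w = S w / sigma2 by [].
rewrite (MSE_loss mpsi hsigma2 hS XE hind hZ hU).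
rewrite (MSE_loss mpsibar hsigma2 hS XE hind hZ hU).
have out (f : R -> R) t : ~~ (0 < t < 1) -> (f \_ `]0%R, 1%R[) t = 0.
  by move=> t01; rewrite patchE memNset//= in_itv/=; exact/negP.
have inn (f : R -> R) t : 0 < t < 1 -> (f \_ `]0%R, 1%R[) t = f t.
  by move=> t01; rewrite patchE mem_set//= in_itv/=.
have mr (f : R -> R) : measurable_fun (`]0, 1[ : set R) f ->
    measurable_fun setT (f \_ `]0%R, 1%R[).
  by move=> mf; exact/(measurable_restrictT f (measurable_itv _)).
have sq t : (psi \_ `]0%R, 1%R[) t ^+ 2 <= (psibar \_ `]0%R, 1%R[) t ^+ 2.
  have [t01|t01] := boolP (0 < t < 1); first by rewrite !inn// hsq.
  by rewrite !out.
apply: le_integral_loss => //; [exact: mr|exact: mr|].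
apply: (le_integral_slope hsigma2 xi _ pmk) => //.
- exact: mr.
- exact: mr.
- exact: out.
- exact: out.
move=> t; rewrite /Delta; have [t01|t01] := boolP (0 < t < 1).
  by rewrite !inn//; exact: hDelta.
by rewrite !out// !subrr mulr0 subr0.
Qed.
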